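(* Let $G$ be a plane multiwheel or a projective plane multiwheel. If $G$ quadrangulates the projective plane, then $G$ belongs to the Grötzsch class.
   Context: All graphs are finite and simple. The wheel $W_m$ ($m\ge 3$) consists of a cycle of length $m$ (the rim) together with a hub joined to every rim vertex by an edge called a spike; it is odd if $m$ is odd, and $w_q$ denotes $W_{2q+1}$. The edge sum modulo two of graphs placed on a common vertex set has as vertices the union of their vertex sets and as edges those edges which belong to an odd number of the graphs. Plane multiwheels: let $k\ge 3$ be odd and let $S_0,\dots,S_{k-1}$ be arbitrary odd wheels. In each $S_i$ choose a vertex $c_i$ and two edges incident with $c_i$ of one of the following types: two rim edges meeting at the rim vertex $c_i$; two consecutive spikes ($c_i$ is the hub and the other ends of the spikes are adjacent on the rim); or a spike and a rim edge meeting at the rim vertex $c_i$. Identify all $c_i$ to one vertex $c$ and, cyclically (indices modulo $k$), identify one of the chosen edges of $S_i$ with one chosen edge of $S_{i+1}$ (the other chosen edge of $S_i$ being identified with a chosen edge of $S_{i-1}$), with no other identifications. The edge sum modulo two of the wheels (so that each wheel loses exactly its two chosen edges) is a plane multiwheel. Projective plane multiwheels: let $q\ge 1$, $k=2q+1$, let $S_0,\dots,S_{k-1}$ be arbitrary odd wheels, and let $C$ be a wheel $w_q$ with hub $z$ and rim cycle $u_0u_1\cdots u_{k-1}$ (indices modulo $k$). In each $S_i$, with hub $h$, choose two consecutive spikes $hr'$ and $hr''$ ($r',r''$ adjacent on the rim) and the rim edge $rr'$ with $r\ne r''$; these form the path $r\,r'\,h\,r''$ with middle edge the spike $r'h$.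 Identify the middle spike of $S_i$ with the edge $u_iu_{i+1}$ of $C$ (in either direction), and for each $i$ identify the chosen edge of $S_i$ other than the middle spike that is incident with $u_{i+1}$ with the chosen edge of $S_{i+1}$ other than the middle spike that is incident with $u_{i+1}$; call the other end of this common edge $v_{i+1}$. The vertices $z,u_i,v_i$ are all distinct and there are no other identifications. The edge sum modulo two of $S_0,\dots,S_{k-1}$ and $C$ is a projective plane multiwheel. The Grötzsch class consists of those projective plane multiwheels in which all $S_i$ are $w_1=W_3=K_4$ (these are the graphs obtained by Mycielski's construction from the odd cycles $C_k$, $k\ge 3$). A graph quadrangulates the projective plane if it can be embedded in the projective plane so that every face is bounded by a cycle of length 4. *)

(* Defs.v *)
From mathcomp Require Import all_boot fingroup perm ssralg ssrint.

Set Implicit Arguments.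
Unset Strict Implicit.
Unset Printing Implicit Defensive.

Import GRing.Theory.

Record sgraph := SGraph {
  vertex :> finType;
  adj : rel vertex;
  adj_sym : symmetric adj;
  adj_irr : irreflexive adj }.

Arguments adj {G} : rename.

Definition edges (G : sgraph) : {set {set G}} :=
  [set [set p.1; p.2] | p in [set p : G * G | adj p.1 p.2]].

(* The edge sum modulo two of a family of graphs (V i, E i) placed on a common
   vertex set; G has no vertices outside the union of the V i. *)
Definition is_edge_sum (G : sgraph) (I : finType)
    (V : I -> {set G}) (E : I -> rel G) : Prop :=
  \bigcup_(i : I) V i = [set: G] /\
  (forall x y : G, adj x y = odd #|[set i | E i x y]|).

Section Wheels.

Variable T : finType.

(* A wheel W_m placed on vertices of T. *)
Record wheel (m : nat) := Wheel {
  hub : T;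
  rim : 'I_m -> T;
  wheel_ge3 : 2 < m;
  rim_inj : injective rim;
  hub_rim : forall r, rim r != hub }.

Section OneWheel.

Variables (m : nat) (W : wheel m).

Definition wverts : {set T} := hub W |: [set rim W r | r : 'I_m].

Definition spike : rel T := fun x y =>
  [exists r, ((x == hub W) && (y == rim W r)) ||
             ((y == hub W) && (x == rim W r))].

Definition rim_edge : rel T := fun x y =>
  [exists r, ((x == rim W r) && (y == rim W (ordS r))) ||
             ((y == rim W r) && (x == rim W (ordS r)))].

Definition wadj : rel T := fun x y => spike x y || rim_edge x y.

(* The edges ca and cb are two rim edges, or two consecutive spikes, or a spike
   and a rim edge meeting at a rim vertex (rim_edge c _ forces c on the rim). *)
Definition chosen_pair (c a b : T) : bool :=
  (a != b) &&
  [|| rim_edge c a && rim_edge c b,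
      [&& c == hub W, spike c a, spike c b & rim_edge a b],
      spike c a && rim_edge c b
    | rim_edge c a && spike c b].

Definition chosen_path (r r' h r'' : T) : bool :=
  [&& h == hub W, spike h r', spike h r'', rim_edge r' r'', rim_edge r r'
    & r != r''].

End OneWheel.

End Wheels.

(* Identified vertices are one and the same vertex of G, and the condition on
   the intersections says that nothing else is identified. The vertex d i is
   the end other than c of the edge common to S_(i-1) and S_i. *)
Definition plane_multiwheel (G : sgraph) : Prop :=
  exists (k : nat) (m : 'I_k -> nat) (S : forall i, wheel G (m i))
         (c : G) (d : 'I_k -> G),
    [/\ odd k /\ 2 < k,
        forall i, odd (m i),
        forall i, chosen_pair (S i) c (d i) (d (ordS i)),
        forall i j, i != j -> wverts (S i) :&: wverts (S j) =
          if j == ordS i then [set c; d j]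
          else if i == ordS j then [set c; d i]
          else [set c]
      & is_edge_sum (fun i => wverts (S i)) (fun i => wadj (S i))].

(* The two alternatives for chosen_path are the two directions in which the
   middle spike of S_i can be identified with u_i u_(i+1). *)
Definition projective_multiwheel_data (G : sgraph) (q : nat)
    (C : wheel G q.*2.+1) (m : 'I_(q.*2.+1) -> nat)
    (S : forall i, wheel G (m i)) (v : 'I_(q.*2.+1) -> G) : Prop :=
  let z := hub C in let u := rim C in
  [/\ forall i, odd (m i),
      forall i, chosen_path (S i) (v i) (u i) (u (ordS i)) (v (ordS i)) ||
                chosen_path (S i) (v (ordS i)) (u (ordS i)) (u i) (v i),
      uniq (z :: codom u ++ codom v),
      (forall i j, i != j -> wverts (S i) :&: wverts (S j) =
         if j == ordS i then [set u j; v j]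
         else if i == ordS j then [set u i; v i]
         else set0) /\
      (forall i, wverts (S i) :&: wverts C = [set u i; u (ordS i)])
    & is_edge_sum
        (fun o => if o is Some i then wverts (S i) else wverts C)
        (fun o => if o is Some i then wadj (S i) else wadj C)].

Definition projective_plane_multiwheel (G : sgraph) : Prop :=
  exists (q : nat) (C : wheel G q.*2.+1) (m : 'I_(q.*2.+1) -> nat)
         (S : forall i, wheel G (m i)) (v : 'I_(q.*2.+1) -> G),
    0 < q /\ projective_multiwheel_data C S v.

Definition grotzsch_class (G : sgraph) : Prop :=
  exists (q : nat) (C : wheel G q.*2.+1) (m : 'I_(q.*2.+1) -> nat)
         (S : forall i, wheel G (m i)) (v : 'I_(q.*2.+1) -> G),
    [/\ 0 < q, projective_multiwheel_data C S v & forall i, m i = 3].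

(* Cellular embeddings of a connected graph in closed surfaces are given by
   embedding schemes: at every vertex v a cyclic order of its neighbours
   (rot v is only meaningful on neighbours of v), and a signature marking the
   edges across which the local orientations of the two ends disagree. *)
Record embedding (G : sgraph) := Embedding {
  rot : G -> {perm G};
  twist : rel G;
  rot_cyclic : forall v w : G, adj v w -> porbit (rot v) w = [set x | adj v x];
  twist_sym : symmetric twist }.

Section Embeddings.

Variables (G : sgraph) (M : embedding G).

(* ((x, y), s): the edge xy traversed from x to y, with s telling whether the
   face is traced against the local orientation at x. *)
Definition flags : pred (G * G * bool) := fun p => adj p.1.1 p.1.2.

Definition face_step (p : G * G * bool) : G * G * bool :=
  let: (x, y, s) := p in
  let s' := s (+) twist M x y in
  (y, if s' then ((rot M y)^-1)%g x else rot M y x, s').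

Definition facial_walk (p : G * G * bool) : seq G :=
  [seq r.1.1 | r <- orbit face_step p].

(* Every facial walk is an orbit of face_step in each of its two directions.
   The embedding of a single vertex has one face, without facial walk. *)
Definition n_faces : nat := maxn 1 (fcard face_step flags)./2.

Definition euler_char : int := (#|G|%:Z - #|edges G|%:Z + n_faces%:Z)%R.

(* By the classification of surfaces the projective plane is the only closed
   connected surface of Euler characteristic 1. *)
Definition in_projective_plane : Prop :=
  (forall x y : G, connect adj x y) /\ euler_char = 1%R.

Definition quadrangular : Prop :=
  forall p, flags p -> ucycle adj (facial_walk p) /\ size (facial_walk p) = 4.

End Embeddings.

Definition quadrangulates_projective_plane (G : sgraph) : Prop :=
  exists M : embedding G, in_projective_plane M /\ quadrangular M.

(* Main.v *)
From HB Require Import structures.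
From mathcomp Require Import all_boot fingroup perm ssralg ssrint zmodp vector zify.
Require Import Defs.

Set Implicit Arguments.
Unset Strict Implicit.
Unset Printing Implicit Defensive.

Import GRing.Theory.

(** In a quadrangulation of the projective plane every face is even, so the
    parity of a closed walk depends only on its homology class modulo two.  As
    there are just two classes, parity separates them, and two odd cycles, being
    one-sided, must meet.  The form of this principle used here is
    [minus_triangle_bipartite]: deleting the vertices of a triangle leaves a
    bipartite graph.

    The principle is proved in the bipartite double cover of the quadrangulation
    M.  Its vertices are x+ and x- for the vertices x, and its edges are the
    darts (x, y), joining x+ to y-.  Vertices, edges and faces are all doubled,
    so its Euler characteristic is 2, and since G contains a triangle it is
    connected.  Counting dimensions over the field with two elements
    ([exact_of_dim]) then shows that its first homology vanishes: every edge set
    of even degrees is the boundary of a set of faces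
    ([even_degrees_boundary]).  Apply this to the preimage of a triangle T, a
    hexagon that the deck transformation (exchanging x+ and x-) preserves, and
    let g be a set of faces that it bounds.  The image of g has the same
    boundary, so it is g or the complement of g ([cover_constant]).  In the first
    case g comes from a set of quadrangular faces of G bounded by the three edges
    of T, which a count modulo 4 forbids.  In the second case, a vertex x outside
    T has all the faces around x+ in g or all of them outside g, and the
    alternative changes along every edge avoiding T: this is a 2-colouring.

    A multiwheel rarely satisfies the principle.  If one of its wheels is not
    K4, then in that wheel two consecutive rim vertices far from the chosen edges
    form a triangle with the hub, and an odd cycle of the multiwheel is disjoint
    from it ([projective_wheels_are_K4], [plane_wheels_are_K4]).  For projective
    plane multiwheels this is already the conclusion.  A plane multiwheel with at
    least four wheels, all equal to K4, has disjoint triangles in two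
    non-consecutive wheels ([plane_three_wheels]); with three wheels it is
    the Mycielski graph of a triangle, which is exhibited as a member of the
    Groetzsch class with q = 1 ([mycielski_triangle_grotzsch]). *)

(** * Flags of an embedding and the faces of the double cover *)

Section FlagMap.

Variables (G : sgraph) (M : embedding G).

Local Notation flag := (G * G * bool)%type.

(** The flag (x, y, s) is the side s of the dart from x to y.  This is the
    neighbouring side at the tail x: the other edge of the same corner of a face. *)
Definition corner (p : flag) : flag :=
  let: (x, y, s) := p in
  (x, if s then rot M x y else ((rot M x)^-1)%g y, ~~ s).

(** The same side of the same edge, seen from the other end; the local
    orientation changes when the direction of travel does, hence the negation. *)
Definition reverse (p : flag) : flag :=
  let: (x, y, s) := p in (y, x, ~~ (s (+) twist M x y)).

Definition opposite (p : flag) : flag := (p.1, ~~ p.2).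

(** The other edge of the same face at the head of a dart. *)
Definition turn (p : flag) : flag := reverse (corner (reverse p)).

(** This presents the embedding by three involutions (corner, reverse,
    opposite), as in a graph-encoded map. *)
Lemma face_stepE p : face_step M p = corner (reverse p).
Proof. by case: p => -[x y] s /=; rewrite negbK; case: (s (+) _). Qed.

Lemma cornerK : involutive corner.
Proof. by move=> [[x y] []] /=; rewrite ?permK ?permKV. Qed.

Lemma reverseK : involutive reverse.
Proof.
move=> [[x y] s] /=; rewrite (twist_sym M y x).
by case: s; case: (twist M x y).
Qed.

Lemma turnK : involutive turn.
Proof. by move=> p; rewrite /turn reverseK cornerK reverseK. Qed.

Lemma reverse_opposite p : reverse (opposite p) = opposite (reverse p).
Proof. by case: p => -[x y] s; rewrite /opposite /= addNb. Qed.

Lemma rot_adj (x y : G) : adj x y -> adj x (rot M x y).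
Proof.
by move=> xy; have := mem_porbit (rot M x) 1 y; rewrite expg1 rot_cyclic // inE.
Qed.

Lemma rotV_adj (x y : G) : adj x y -> adj x (((rot M x)^-1)%g y).
Proof.
move=> xy; have := mem_porbit ((rot M x)^-1)%g 1 y.
by rewrite expg1 porbitV rot_cyclic // inE.
Qed.

Lemma flags_corner p : flags p -> flags (corner p).
Proof.
by case: p => -[x y] [] xy; [exact: rot_adj | exact: rotV_adj].
Qed.

Lemma flags_reverse p : flags p -> flags (reverse p).
Proof. by case: p => -[x y] s; rewrite /flags /= adj_sym. Qed.

Lemma flags_turn p : flags p -> flags (turn p).
Proof. by move=> pF; apply/flags_reverse/flags_corner/flags_reverse. Qed.

Lemma face_step_inj : injective (face_step M).
Proof.
by move=> p q; rewrite !face_stepE => /(can_inj cornerK)/(can_inj reverseK).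
Qed.

(** Each edge carries two darts.  The lemma is also applied to auxiliary graphs
    on the vertices of another one, as a proof that a symmetric set of darts is
    even. *)
Lemma card_edges : #|[set d : G * G | adj d.1 d.2]| = #|edges G| * 2.
Proof.
rewrite -sum1_card (partition_big_imset (fun d : G * G => [set d.1; d.2])) /=.
rewrite -sum_nat_const; apply: eq_bigr => E /imsetP[[x y] /[!inE]/= xy ->].
have nxy : (x, y) != (y, x).
  by apply: contraTneq xy => -[-> _]; rewrite adj_irr.
have <-: #|[set (x, y); (y, x)]| = 2 by rewrite cards2 nxy.
rewrite sum1_card; apply: eq_card => -[a b].
rewrite unfold_in !inE /= !xpair_eqE.
apply/andP/orP => [[ab /eqP Eab]|[]/andP[/eqP-> /eqP->]]; last 2 first.
- by [].
- by rewrite adj_sym setUC.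
have: a \in [set x; y] by rewrite -Eab set21.
have: b \in [set x; y] by rewrite -Eab set22.
by rewrite !inE => /orP[]/eqP eb /orP[]/eqP ea; subst;
  rewrite ?eqxx ?adj_irr in ab *; auto.
Qed.

Hypothesis quadM : quadrangular M.

Lemma order_face_step p : flags p -> fingraph.order (face_step M) p = 4.
Proof. by move=> /quadM[_]; rewrite /facial_walk size_map size_orbit. Qed.

Lemma face_step4 p : flags p -> iter 4 (face_step M) p = p.
Proof. by move=> pF; rewrite -(order_face_step pF) (iter_order face_step_inj). Qed.

Lemma opposite_tails p : flags p ->
  (face_step M (face_step M p)).1.1 != p.1.1.
Proof.
move=> pF; have [/andP[_]] := quadM pF; rewrite /facial_walk /orbit.
rewrite order_face_step //= !inE => /andP[/norP[_ /norP[n _]] _] _.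
by rewrite eq_sym.
Qed.

Lemma face_step_tail p : (face_step M p).1.1 = p.1.2.
Proof. by case: p => -[x y] s. Qed.

Lemma corner_head p : flags p -> (corner p).1.2 != p.1.2.
Proof.
move=> pF; have := opposite_tails (flags_reverse pF).
by rewrite face_step_tail face_stepE reverseK; case: p pF => -[x y] s.
Qed.

Lemma turn_tail p : flags p -> (turn p).1.1 != p.1.1.
Proof.
move=> pF; have := opposite_tails pF.
by rewrite face_step_tail face_stepE /turn; case: (corner _) => -[x y] s.
Qed.

Lemma corner_tail p : (corner p).1.1 = p.1.1.
Proof. by case: p => -[x y] s. Qed.

Lemma turn_head p : (turn p).1.2 = p.1.2.
Proof. by case: p => -[x y] s. Qed.

(** On a quadrangle, corner and reverse generate a dihedral group of order 8, and
    both compositions are its half turn. *)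
Lemma turn_corner p : flags p -> turn (corner p) = corner (turn p).
Proof.
move=> /face_step4; rewrite /= !face_stepE /turn => /(canRL cornerK).
by move=> /(canRL reverseK) /(canRL cornerK) /(canRL reverseK) ->.
Qed.

(** A quadrangle x0 x1 x2 x3 lifts to the double cover as the closed walk
    x0+ x1- x2+ x3-, whose edges are the darts out of x0 and x2.  Taking corner
    and turn, but not reverse, keeps the tails of darts in the same colour. *)
Definition cover_face (p : flag) : {set flag} :=
  [set p; corner p; turn p; corner (turn p)].

Definition cover_faces := [set cover_face p | p : flag & flags p].

Lemma cover_face_corner p : flags p -> cover_face (corner p) = cover_face p.
Proof.
move=> pF; rewrite /cover_face cornerK turn_corner // cornerK.
apply/setP=> q; rewrite !inE.
by case: (q == p); case: (q == corner p); case: (q == turn p);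
  case: (q == corner (turn p)).
Qed.

Lemma cover_face_turn p : flags p -> cover_face (turn p) = cover_face p.
Proof.
move=> pF; rewrite /cover_face turnK.
apply/setP=> q; rewrite !inE.
by case: (q == p); case: (q == corner p); case: (q == turn p);
  case: (q == corner (turn p)).
Qed.

Lemma cover_face_id p : p \in cover_face p.
Proof. by rewrite !inE eqxx. Qed.

Lemma cover_face_eq p q : flags p -> q \in cover_face p ->
  flags q /\ cover_face q = cover_face p.
Proof.
move=> pF; have tF := flags_turn pF; have cF := flags_corner pF.
rewrite !inE -!orbA => /or4P[]/eqP->; split=> //.
- exact: cover_face_corner.
- exact: cover_face_turn.
- exact: flags_corner.
- by rewrite cover_face_corner // cover_face_turn.
Qed.

Lemma card_cover_face p : flags p -> #|cover_face p| = 4.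
Proof.
move=> pF; have nc := corner_head pF; have nt := turn_tail pF.
have nc' := corner_head (flags_turn pF); rewrite turn_head in nc'.
have -> : cover_face p = [set q in [:: p; corner p; turn p; corner (turn p)]].
  by apply/setP=> q; rewrite !inE -!orbA.
rewrite cardsE; apply/card_uniqP; rewrite /= !inE !andbT !negb_or.
have tails (q r : flag) : r.1.1 != q.1.1 -> q != r.
  by apply: contraNneq => ->.
have heads (q r : flag) : r.1.2 != q.1.2 -> q != r.
  by apply: contraNneq => ->.
by rewrite heads // 4?tails ?corner_tail // heads // turn_head.
Qed.

(** Each face of the cover has four of the sides of darts, and there are four of
    these sides for each edge of G. *)
Lemma card_cover_faces : #|cover_faces| = #|edges G|.
Proof.
have -> : #|cover_faces| = (#|cover_faces| * 4) %/ 4 by rewrite mulnK.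
rewrite -(@card_uniform_partition _ 4 _ [set p : flag | flags p]).
- have -> : [set p : flag | flags p] =
            setX [set d : G * G | adj d.1 d.2] [set: bool].
    by apply/setP=> -[[x y] s]; rewrite !inE /= andbT.
  by rewrite cardsX cardsT card_bool card_edges -mulnA mulnK.
- by move=> A /imsetP[p /[!inE] pF ->]; exact: card_cover_face.
apply/and3P; split.
- rewrite eqEsubset; apply/andP; split.
    apply/bigcupsP=> A /imsetP[p /[!inE] pF ->]; apply/subsetP=> q.
    by move=> /(cover_face_eq pF)[]; rewrite inE.
  apply/subsetP=> p; rewrite inE => pF; apply/bigcupP.
  by exists (cover_face p); [apply: imset_f; rewrite inE | apply: cover_face_id].
- apply/trivIsetP=> A B /imsetP[p /[!inE] pF ->] /imsetP[q /[!inE] qF ->].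
  apply: contraR => /pred0Pn[r /andP[/(cover_face_eq pF)[_ <-]]].
  by move=> /(cover_face_eq qF)[_ <-].
by apply/negP=> /imsetP[p _ /setP/(_ p)]; rewrite cover_face_id inE.
Qed.

End FlagMap.

(** * Exactness from dimensions, and connectivity of the double cover *)

(** If f has at most a line as its kernel and the image of g, together with one
    vector, spans, then the dimension count forces the image of f to fill the
    kernel of g. *)
Lemma exact_of_dim (K : fieldType) (U V W : vectType K) (f : U -> V)
    (g : V -> W) (u0 : U) (w0 : W) :
  linear f -> linear g -> (forall u, g (f u) = 0%R) ->
  (forall u, f u = 0%R -> exists k : K, u = (k *: u0)%R) ->
  (forall L : {vspace W}, w0 \in L -> (forall v, g v \in L) -> L = fullv) ->
  dim V + 2 <= dim U + dim W ->
  forall v, g v = 0%R -> exists u, v = f u.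
Proof.
move=> linf ling gf0 kerf img dimUVW v gv0.
pose fL : {linear U -> V} := HB.pack f (GRing.isLinear.Build _ _ _ _ f linf).
pose gL : {linear V -> W} := HB.pack g (GRing.isLinear.Build _ _ _ _ g ling).
pose F := linfun fL; pose H := linfun gL.
have FE u : F u = f u by exact: (lfunE fL).
have HE w : H w = g w by exact: (lfunE gL).
have dimF : \dim (lker F) <= 1.
  apply: (@leq_trans (\dim <[u0]>)); last by rewrite dim_vline leq_b1.
  apply: dimvS; apply/subvP=> u; rewrite memv_ker FE => /eqP/kerf[k ->].
  by rewrite memvZ ?memv_line.
have dimH : dim W <= \dim (limg H) + 1.
  rewrite -[dim W]dimvf -(img (limg H + <[w0]>)%VS).
  - by apply: leq_trans (dimv_add_leqif _ _) _; rewrite leq_add2l dim_vline leq_b1.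
  - by rewrite memvE addvSr.
  by move=> w; rewrite -HE memvE (subv_trans _ (addvSl _ _)) // -memvE memv_img ?memvf.
have := limg_ker_dim F fullv; have := limg_ker_dim H fullv.
rewrite !capfv !dimvf => dimVE dimUE.
have imker : (limg F <= lker H)%VS.
  by apply/subvP=> _ /memv_imgP[u _ ->]; rewrite memv_ker HE FE gf0.
have /eqP imE : limg F == lker H.
  by rewrite eqEdim imker /=; lia.
have : v \in limg F by rewrite imE memv_ker HE gv0.
by case/memv_imgP=> u _; exists u; rewrite -FE.
Qed.


Section Connectivity.

Variables (G : sgraph) (conn : forall x y : G, connect adj x y).

Lemma connected_ind (P : G -> Prop) (x0 : G) :
  (forall x y : G, adj x y -> P x -> P y) -> P x0 -> forall x, P x.
Proof.
move=> Padj Px0 x; have /connectP[p xp ->] := conn x0 x.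
elim: p x0 Px0 xp => //= y p IHp x0 Px0 /andP[xy yp].
by apply: IHp yp; apply: Padj xy Px0.
Qed.

Variables (a b c : G).
Hypotheses (ab : adj a b) (bc : adj b c) (ca : adj c a).

(** Read P and Q as a function on the vertices x+ and y- of the double cover that
    is constant along its edges.  Two steps return to the same sheet, and going
    around the triangle a, b, c changes the sheet, so everything is connected. *)
Lemma double_cover_connected (T : Type) (P Q : G -> T) :
  (forall x y : G, adj x y -> P x = Q y) -> forall x y, P x = P y /\ Q x = P y.
Proof.
move=> PQ.
have QP (x y : G) : adj x y -> Q x = P y by rewrite adj_sym => /PQ.
have eqPQ : forall x, P x = Q x.
  apply: (@connected_ind _ a) => [x y xy eqx|].
    by rewrite -(QP _ _ xy) -(PQ _ _ xy).
  by rewrite (PQ _ _ ab) (QP _ _ bc) (PQ _ _ ca).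
move=> x y; rewrite -eqPQ; suff: P x = P y by [].
move: y; apply: (@connected_ind (fun y => P x = P y) x) => // y z yz ->.
by rewrite eqPQ (QP _ _ yz).
Qed.

End Connectivity.

(** * Vanishing homology of the double cover *)

Lemma F2_addrr (x : 'F_2) : (x + x = 0)%R.
Proof. by apply/eqP; case: x => -[|[|]]. Qed.

Lemma F2_add_eq0 (x y : 'F_2) : (x + y = 0)%R -> x = y.
Proof. by move=> xy0; rewrite -[x]addr0 -(F2_addrr y) addrA xy0 add0r. Qed.

Lemma F2_add_neq0 (x y : 'F_2) :
  (x + y != 0)%R = (x != 0)%R (+) (y != 0)%R.
Proof. by case: x y => -[|[|//]] i [[|[|//]] j]. Qed.

Section CoverHomology.

Variables (G : sgraph) (M : embedding G).
Hypothesis quadM : quadrangular M.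
Hypothesis conn : forall x y : G, connect adj x y.
Variables (a b c : G).
Hypotheses (ab : adj a b) (bc : adj b c) (ca : adj c a).

Local Notation flag := (G * G * bool)%type.

(** Corner followed by opposite moves one step in the rotation at x, which by
    assumption is transitive on the neighbours of x. *)
Lemma vertex_constant (T : Type) (F : flag -> T) (x : G) :
  (forall y s, adj x y -> F (x, y, ~~ s) = F (x, y, s)) ->
  (forall y s, adj x y -> F (corner M (x, y, s)) = F (x, y, s)) ->
  forall y z s t, adj x y -> adj x z -> F (x, y, s) = F (x, z, t).
Proof.
move=> Fopp Fcor y z s t xy xz.
have side u r : adj x u -> F (x, u, r) = F (x, u, false).
  by case: r => // /(Fopp _ false).
rewrite !side //.
have : z \in porbit (rot M x) y by rewrite (rot_cyclic M xy) inE.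
case/porbitP=> i ->; elim: i => [|i IHi]; first by rewrite expg0 perm1.
rewrite expgSr permM IHi.
have adji : adj x ((rot M x ^+ i)%g y).
  by have := mem_porbit (rot M x) i y; rewrite (rot_cyclic M xy) inE.
by rewrite -(side _ true adji) -(Fcor _ true adji).
Qed.

Definition some_nbr (x : G) : G := odflt x [pick y | adj x y].

Lemma some_nbr_adj (x y : G) : adj x y -> adj x (some_nbr x).
Proof. by rewrite /some_nbr; case: pickP => //= /(_ y) ->. Qed.

(** A function on the faces of the double cover that does not change across edges
    is constant: it descends to the vertices of the cover, which is connected. *)
Lemma cover_constant (T : Type) (F : flag -> T) :
  (forall p, flags p -> F (opposite p) = F p) ->
  (forall p, flags p -> F (corner M p) = F p) ->
  (forall p, flags p -> F (turn M p) = F p) ->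
  forall p q, flags p -> flags q -> F p = F q.
Proof.
move=> Fopp Fcor Ftur.
pose F' p := F (reverse M p).
have Fx (x y : G) s : adj x y -> F (x, y, s) = F (x, some_nbr x, false).
  move=> xy; apply: vertex_constant (some_nbr_adj xy) => //.
  - by move=> z t xz; apply: (Fopp (x, z, t)).
  - by move=> z t xz; apply: (Fcor (x, z, t)).
have Fy (x y : G) s : adj y x -> F' (y, x, s) = F' (y, some_nbr y, false).
  move=> yx; apply: vertex_constant (some_nbr_adj yx) => //.
  - move=> z t yz; rewrite /F' -(Fopp (reverse M (y, z, t))) ?flags_reverse //.
    by rewrite -reverse_opposite.
  - move=> z t yz; rewrite /F' -(Ftur (reverse M (y, z, t))) ?flags_reverse //.
    by rewrite /turn reverseK.
have PQ (x y : G) : adj x y -> F (x, some_nbr x, false) = F' (y, some_nbr y, false).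
  move=> xy; rewrite -(Fx x y false xy) -(Fy x y (reverse M (x, y, false)).2).
    by rewrite /F' -[(y, x, _)]/(reverse M (x, y, false)) reverseK.
  by rewrite adj_sym.
move=> [[x y] s] [[z t] r] xy zt; rewrite Fx // [RHS]Fx //.
by case: (double_cover_connected conn ab bc ca PQ x z).
Qed.

Lemma corner_flags p : flags (corner M p) = flags p.
Proof.
apply/idP/idP => [/flags_corner|]; last exact: flags_corner.
by move=> /(_ M); rewrite cornerK.
Qed.

Lemma reverse_flags p : flags (reverse M p) = flags p.
Proof.
apply/idP/idP => [/flags_reverse|]; last exact: flags_reverse.
by move=> /(_ M); rewrite reverseK.
Qed.

(** Corner pairs off the sides of the darts with tail x, without fixed points. *)
Lemma tail_sum0 (F : flag -> 'F_2) (x : G) :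
  (forall p, flags p -> F (corner M p) = F p) ->
  (\sum_(p : flag | flags p && (p.1.1 == x)) F p = 0)%R.
Proof.
move=> Fcor; rewrite (bigID (fun p : flag => p.2)) /=.
rewrite (reindex_inj (can_inj (@cornerK _ M))) /=.
rewrite (eq_big (fun p : flag => (flags p && (p.1.1 == x)) && ~~ p.2) F).
- exact: F2_addrr.
- by move=> p; rewrite corner_flags corner_tail; case: p => -[? ?] ?.
by move=> p /andP[/andP[+ _] _]; rewrite corner_flags => /Fcor.
Qed.

Lemma head_sum0 (F : flag -> 'F_2) (x : G) :
  (forall p, flags p -> F (turn M p) = F p) ->
  (\sum_(p : flag | flags p && (p.1.2 == x)) F p = 0)%R.
Proof.
move=> Ftur; rewrite (reindex_inj (can_inj (@reverseK _ M))) /=.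
rewrite -[RHS](@tail_sum0 (fun p => F (reverse M p)) x).
  apply: eq_bigl => p.
  by rewrite reverse_flags; case: p => -[? ?] ?.
move=> p pF; rewrite -(Ftur (reverse M p)) ?flags_reverse //.
by rewrite /turn reverseK.
Qed.

Definition darts : {pred G * G} := [pred d | adj d.1 d.2].

Local Notation face := {A in cover_faces M}.
Local Notation dart := {d in darts}.

(** A chain g of faces of the cover, as a function on flags: its coefficient at
    the face that contains the flag. *)
Definition face_value (g : {ffun face -> ('F_2)^o}) (p : flag) : 'F_2 :=
  (\sum_(A : face | p \in val A) g A)%R.

Definition boundary (g : {ffun face -> ('F_2)^o}) : {ffun dart -> ('F_2)^o} :=
  [ffun d => face_value g (val d, true) + face_value g (val d, false)]%R.

(** The boundary of a chain of edges of the cover; inl x is the vertex x+ and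
    inr y is the vertex y-. *)
Definition ends (v : {ffun dart -> ('F_2)^o}) : {ffun G + G -> ('F_2)^o} :=
  [ffun z => match z with
    | inl x => \sum_(d : dart | (val d).1 == x) v d
    | inr y => \sum_(d : dart | (val d).2 == y) v d
    end]%R.

Lemma face_value_linear (k : 'F_2) g h p :
  face_value (k *: g + h)%R p = (k * face_value g p + face_value h p)%R.
Proof.
rewrite /face_value big_distrr -big_split /=.
by apply: eq_bigr => A _; rewrite !ffunE.
Qed.

Lemma boundary_linear : linear boundary.
Proof.
move=> k g h; apply/ffunP=> d; rewrite !ffunE !face_value_linear.
by rewrite -[(k *: _)%R]/(k * _)%R mulrDr addrACA.
Qed.

Lemma ends_linear : linear ends.
Proof.
move=> k v w; apply/ffunP=> -[x|y]; rewrite !ffunE scaler_sumr -big_split /=;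
  by apply: eq_bigr => d _; rewrite !ffunE.
Qed.

Lemma face_value_closed g p q :
  flags p -> q \in cover_face M p -> face_value g q = face_value g p.
Proof.
move=> pF qp; have [qF qE] := cover_face_eq quadM pF qp.
apply: eq_bigl => -[A /= Af]; case/imsetP: (Af) => r /[!inE] rF ->.
apply/idP/idP => /(cover_face_eq quadM rF)[_ <-]; last by [].
by rewrite qE cover_face_id.
Qed.

Lemma face_value_corner g p : flags p -> face_value g (corner M p) = face_value g p.
Proof. by move=> pF; apply: face_value_closed; rewrite // !inE eqxx ?orbT. Qed.

Lemma face_value_turn g p : flags p -> face_value g (turn M p) = face_value g p.
Proof. by move=> pF; apply: face_value_closed; rewrite // !inE eqxx ?orbT. Qed.

Lemma sum_sides (F : flag -> 'F_2) (P : pred (G * G)) :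
  (\sum_(d : dart | P (val d)) (F (val d, true) + F (val d, false)) =
   \sum_(p : flag | flags p && P p.1) F p)%R.
Proof.
rewrite -(big_sub_cond darts P (fun d => F (d, true) + F (d, false))%R).
rewrite [RHS](eq_big (fun p : flag => ((p.1 \in darts) && P p.1) && true)
  (fun p => F (p.1, p.2))).
- rewrite -(pair_big (fun d => (d \in darts) && P d) xpredT (fun d s => F (d, s))).
  by apply: eq_bigr => d _; rewrite big_bool.
- by move=> p; rewrite andbT.
by case.
Qed.

Lemma ends_boundary g : ends (boundary g) = 0%R.
Proof.
apply/ffunP=> -[x|y]; rewrite !ffunE; under eq_bigr do rewrite ffunE.
  rewrite (sum_sides (face_value g) (fun d => d.1 == x)).
  exact: tail_sum0 (face_value_corner g).
rewrite (sum_sides (face_value g) (fun d => d.2 == y)).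
exact: head_sum0 (face_value_turn g).
Qed.

Lemma boundary_kernel g : boundary g = 0%R ->
  exists k : 'F_2, g = (k *: [ffun _ => 1])%R.
Proof.
move=> g0; exists (face_value g (a, b, true)); apply/ffunP=> -[A Af].
rewrite !ffunE -[(_ *: _)%R]/(_ * 1)%R mulr1.
case/imsetP: (Af) => p /[!inE] pF Ap.
transitivity (face_value g p).
  rewrite /face_value (big_pred1 (exist _ A Af)) // => -[B Bf] /=.
  rewrite -val_eqE /=; case/imsetP: (Bf) => q /[!inE] qF Bq.
  apply/idP/eqP => [|->]; last by rewrite Ap cover_face_id.
  by rewrite Ap Bq => /(cover_face_eq quadM qF)[_ ->].
apply: cover_constant => //; last 2 first.
- exact: face_value_corner.
- exact: face_value_turn.
move=> -[[x y] s] xy; have xyd : (x, y) \in darts by [].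
have := congr1 (fun v : {ffun dart -> ('F_2)^o} => v (Sub (x, y) xyd)) g0.
rewrite !ffunE /= => /F2_add_eq0 e.
by case: s xy; rewrite /opposite /= e.
Qed.

(** The boundary of the dart (x, y) is x+ plus y-, so modulo the boundaries all
    vertices of the connected cover agree. *)
Lemma ends_image (L : {vspace {ffun G + G -> ('F_2)^o}}) :
  [ffun z => (z == inl a)%:R]%R \in L -> (forall v, ends v \in L) -> L = fullv.
Proof.
pose delta z0 : {ffun G + G -> ('F_2)^o} := [ffun z => (z == z0)%:R]%R.
rewrite -/(delta (inl a)) => La endsL.
have Lxy (x y : G) : adj x y -> (delta (inl x) \in L) = (delta (inr y) \in L).
  move=> xy; have xyd : (x, y) \in darts by [].
  pose d0 : dart := Sub (x, y) xyd.
  have := endsL [ffun d => (d == d0)%:R]%R.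
  set w := ends _; have -> : w = (delta (inl x) + delta (inr y))%R.
    have delta_sum (P : pred dart) :
        (\sum_(d | P d) [ffun d => (d == d0)%:R : 'F_2] d = (P d0)%:R)%R.
      case Pd0: (P d0).
        rewrite (bigD1 d0) //= ffunE eqxx big1 ?addr0 // => d /andP[_ /negPf dd0].
        by rewrite ffunE dd0.
      rewrite big1 // => d Pd; rewrite ffunE; case: eqP => // dd0.
      by rewrite -dd0 Pd in Pd0.
    by apply/ffunP=> -[z|z]; rewrite !ffunE ?addr0 ?add0r delta_sum eq_sym.
  move=> Lw; apply/idP/idP => [Lx|Ly].
    by rewrite -(rpredDl _ Lx).
  by rewrite -(rpredDr _ Ly).
have Lall z : delta z \in L.
  have Pa := double_cover_connected conn ab bc ca Lxy.
  by case: z => x; [rewrite (proj1 (Pa x a)) | rewrite (proj2 (Pa x a))].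
apply/eqP; rewrite eqEsubv subvf; apply/subvP=> w _.
have -> : w = (\sum_z w z *: delta z)%R.
  have scaleE z y : ((w z *: delta z) y = w z * (y == z)%:R)%R.
    by rewrite 2!ffunE.
  apply/ffunP=> y; rewrite sum_ffunE.
  transitivity (\sum_z (w z * (y == z)%:R) : 'F_2)%R.
    rewrite (bigD1 y) // eqxx mulr1 big1; first by rewrite /= addr0.
    by move=> z; rewrite eq_sym => /negPf ->; rewrite mulr0.
  by apply: eq_bigr => z _; rewrite scaleE.
by apply: memv_suml => z _; apply: memvZ.
Qed.

(** The first homology of the double cover vanishes.  With n, e and f vertices,
    edges and faces of G, the cover has 2n, 2e and 2f of them and e = 2f, so that
    the bound on the number of edges says that its Euler characteristic is at
    least 2. *)
Lemma even_degrees_boundary (t : rel G) :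
  #|edges G| + 2 <= 2 * #|G| ->
  (forall x, ~~ odd #|[set y | adj x y && t x y]|) ->
  (forall y, ~~ odd #|[set x | adj x y && t x y]|) ->
  exists g : flag -> bool,
    [/\ forall p, flags p -> g (corner M p) = g p,
        forall p, flags p -> g (turn M p) = g p
      & forall p, flags p -> g p (+) g (opposite p) = t p.1.1 p.1.2].
Proof.
move=> euler evenl evenr.
pose v : {ffun dart -> ('F_2)^o} := [ffun d => (t (val d).1 (val d).2)%:R]%R.
have natr_even n : ~~ odd n -> (n%:R = 0 :> 'F_2)%R.
  by move=> /even_halfK <-; rewrite -addnn natrD F2_addrr.
have endsv : ends v = 0%R.
  apply/ffunP=> -[x|y]; rewrite !ffunE; under eq_bigr do rewrite ffunE.
    rewrite -(big_sub_cond darts (fun d => d.1 == x) (fun d => (t d.1 d.2)%:R%R)).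
    rewrite (reindex_onto (fun y => (x, y)) (fun d => d.2)) /=; last first.
      by case=> z y /andP[_ /eqP/= ->].
    rewrite -natr_sum -[RHS](natr_even _ (evenl x)); congr (_%:R)%R.
    rewrite -sum1_card [RHS]big_mkcond [LHS]big_mkcond; apply: eq_bigr => y _.
    by rewrite !inE /= ?eqxx ?andbT; case: (adj x y).
  rewrite -(big_sub_cond darts (fun d => d.2 == y) (fun d => (t d.1 d.2)%:R%R)).
  rewrite (reindex_onto (fun x => (x, y)) (fun d => d.1)) /=; last first.
    by case=> x z /andP[_ /eqP/= ->].
  rewrite -natr_sum -[RHS](natr_even _ (evenr y)); congr (_%:R)%R.
  rewrite -sum1_card [RHS]big_mkcond [LHS]big_mkcond; apply: eq_bigr => x _.
  by rewrite !inE /= ?eqxx ?andbT; case: (adj x y).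
have [] := @exact_of_dim _ _ _ _ boundary ends [ffun _ => 1]%R
  [ffun z => (z == inl a)%:R]%R boundary_linear ends_linear ends_boundary
  boundary_kernel ends_image _ v endsv.
  have -> : dim {ffun dart -> ('F_2)^o} = #|edges G| * 2.
    rewrite -card_edges cardsE -card_sig; exact: muln1.
  have -> : dim {ffun G + G -> ('F_2)^o} = 2 * #|G|.
    by rewrite mul2n -addnn -card_sum; exact: muln1.
  have -> : dim {ffun face -> ('F_2)^o} = #|edges G|.
    by rewrite -(card_cover_faces quadM) -card_sig; exact: muln1.
  by lia.
move=> g gv; exists (fun p => face_value g p != 0%R); split.
- by move=> p /face_value_corner ->.
- by move=> p /face_value_turn ->.
move=> -[[x y] s] xy; have xyd : (x, y) \in darts by [].
rewrite /= -F2_add_neq0.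
have := congr1 (fun v : {ffun dart -> ('F_2)^o} => v (Sub (x, y) xyd)) gv.
rewrite !ffunE /= => e.
transitivity ((t x y)%:R != 0 :> 'F_2)%R; last by case: (t x y).
by rewrite e; case: s xy => _; rewrite // addrC.
Qed.

End CoverHomology.

(** * Deleting a triangle from a quadrangulation *)

Section Quadrangulation.

Variables (G : sgraph) (M : embedding G).
Hypotheses (quadM : quadrangular M) (planeM : in_projective_plane M).

Local Notation flag := (G * G * bool)%type.

Lemma face_step_invariant_card (A : pred flag) :
  {subset A <= @flags G} ->
  (forall p, A (face_step M p) = A p) -> #|A| = fcard (face_step M) A * 4.
Proof.
move=> AF Astep; rewrite (fcard_order_set (@face_step_inj _ M)) //.
  by apply/subsetP=> p /AF pF; rewrite inE (order_face_step quadM).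
by move=> p q /eqP <-; apply/esym/Astep.
Qed.

(** Euler's formula, with one orbit of face_step for each edge because every orbit
    has four flags. *)
Lemma quadrangulation_edge_bound : 1 < #|G| -> #|edges G| + 2 <= 2 * #|G|.
Proof.
move=> G2; have [_] := planeM; rewrite /euler_char /n_faces.
have fclosed p : flags (face_step M p) = flags p.
  by rewrite face_stepE corner_flags reverse_flags.
have := @face_step_invariant_card (@flags G) (fun _ => id) fclosed.
have -> : #|@flags G| = #|edges G| * 4.
  rewrite -[4]/(2 * 2) mulnA -card_edges -[X in _ * X]card_bool -cardsT -cardsX.
  by rewrite -cardsE; apply: eq_card => -[[x y] s]; rewrite !inE andbT.
by move=> /eqP; rewrite eqn_pmul2r // => /eqP <-; lia.
Qed.

Variables (a b c : G).
Hypotheses (ab : adj a b) (bc : adj b c) (ca : adj c a).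

Let T := [set a; b; c].

Lemma adj_neq (x y : G) : adj x y -> x != y.
Proof. by apply: contraTneq => ->; rewrite adj_irr. Qed.

Lemma triangle_adj x y : x \in T -> y \in T -> adj x y = (x != y).
Proof.
have ba : adj b a by rewrite adj_sym.
have cb : adj c b by rewrite adj_sym.
have ac : adj a c by rewrite adj_sym.
rewrite !inE -!orbA => /or3P[]/eqP-> /or3P[]/eqP->;
  by rewrite ?eqxx ?adj_irr // ?ab ?bc ?ca ?ba ?cb ?ac adj_neq.
Qed.

Lemma card_triangle : #|T| = 3.
Proof.
have -> : T = [set x in [:: a; b; c]] by apply/setP=> x; rewrite !inE orbA.
rewrite cardsE; apply/card_uniqP; rewrite /= !inE negb_or !andbT.
by rewrite -!triangle_adj ?inE ?eqxx ?orbT // ab bc (adj_sym a c) ca.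
Qed.

Lemma triangle_degree x : x \in T -> #|[set y | adj x y && (y \in T)]| = 2.
Proof.
move=> xT; have := cardsD1 x T; rewrite xT card_triangle => -[->].
apply: eq_card => y; rewrite inE in_setD1 -/T.
by case yT: (y \in T); rewrite ?andbF // !andbT triangle_adj // eq_sym.
Qed.

(** The set of faces g of the double cover is bounded by the preimage of the
    triangle T.  The function h compares it with its image under the deck
    transformation, which is reverse on flags. *)
Lemma quadrangulation_minus_triangle_bipartite :
  exists P : G -> bool, forall x y,
    adj x y -> x \notin T -> y \notin T -> P x != P y.
Proof.
have [conn _] := planeM.
pose t (x y : G) := (x \in T) && (y \in T).
have G2 : 1 < #|G|.
  by apply/card_gt1P; exists a, b; rewrite // adj_neq.
have evenl x : ~~ odd #|[set y | adj x y && t x y]|.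
  case xT: (x \in T); last first.
    by rewrite (_ : [set y | _] = set0) ?cards0 //; apply/setP=> y; rewrite !inE /t xT andbF.
  rewrite (_ : [set y | _] = [set y | adj x y && (y \in T)]) ?triangle_degree //.
  by apply/setP=> y; rewrite inE [in RHS]inE /t xT.
have evenr y : ~~ odd #|[set x | adj x y && t x y]|.
  rewrite (_ : [set x | _] = [set x | adj y x && t y x]) //.
  by apply/setP=> x; rewrite inE [in RHS]inE adj_sym /t (andbC (x \in T)).
have [g [gcor gtur gopp]] :=
  even_degrees_boundary quadM conn ab bc ca (quadrangulation_edge_bound G2) evenl evenr.
pose h p := g p (+) g (reverse M p).
have hconst : forall p q, flags p -> flags q -> h p = h q.
  apply: (cover_constant (M := M) conn ab bc ca) => p pF; rewrite /h.
  - rewrite reverse_opposite.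
    have := gopp _ pF; have := gopp _ (flags_reverse M pF).
    rewrite (_ : t (reverse M p).1.1 _ = t p.1.1 p.1.2); last first.
      by case: p {pF} => -[x y] s; rewrite /t andbC.
    by do 4 case: (g _); case: (t _ _).
  - rewrite gcor // -(gtur (reverse M p)) ?flags_reverse //.
    by rewrite /turn reverseK.
  - by rewrite gtur // /turn reverseK gcor // flags_reverse.
have goppN x y s : adj x y -> x \notin T -> g (x, y, ~~ s) = g (x, y, s).
  move=> xy /negPf xT; have := gopp (x, y, s) xy; rewrite /t /= xT.
  by rewrite /opposite /=; do 2 case: (g _).
have [h1|h0] : {forall p, flags p -> h p} + {forall p, flags p -> h p = false}.
  (* The image of g is either g or its complement. *)
  case hab: (h (a, b, false)); [left|right]=> p pF;
    by rewrite (hconst p (a, b, false)).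
- have gP x y s : adj x y -> x \notin T -> g (x, y, s) = g (x, some_nbr x, false).
    move=> xy xT; apply: (vertex_constant (M := M)) (some_nbr_adj xy) => // z r xz.
    + exact: goppN.
    + exact: gcor.
  exists (fun x => g (x, some_nbr x, false)) => x y xy xT yT.
  have := h1 (x, y, false) xy; rewrite /h /= gP // gP //.
    by do 2 case: (g _).
  by rewrite adj_sym.
exfalso.
(* Here g comes from a set of quadrangles of G.  Its flags number 4 per orbit of
   face_step.  They also number 1 for each of the six darts of T and 2 for each
   dart with both sides in the set; the darts of the latter kind come in
   opposite pairs.  Modulo 4 this gives 0 = 6. *)
have grev p : flags p -> g (reverse M p) = g p.
  by move=> /h0; rewrite /h; do 2 case: (g _).
pose both : rel G := fun x y => [&& adj x y, g (x, y, false) & g (x, y, true)].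
have both_sym : symmetric both.
  have sub x y : both x y -> both y x.
    move=> /and3P[xy g0 g1]; have yx : adj y x by rewrite adj_sym.
    apply/and3P; split=> //; rewrite -grev //= ; by case: (~~ _).
  by move=> x y; apply/idP/idP; apply: sub.
have both_irr : irreflexive both by move=> x; rewrite /both adj_irr.
(* The darts with both sides in g are those of a graph, hence even in number. *)
have := card_edges (SGraph both_sym both_irr) => /= card_both.
have card_t : #|[set d : G * G | adj d.1 d.2 && t d.1 d.2]| = 6.
  rewrite -sum1dep_card.
  rewrite (eq_bigl (fun d => (d.1 \in T) && (adj d.1 d.2 && (d.2 \in T)))).
    rewrite -(pair_big_dep (fun x => x \in T) (fun x y => adj x y && (y \in T))
      (fun _ _ => 1)) /=.
    rewrite (eq_bigr (fun _ => 2)) => [|x xT].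
      by rewrite sum_nat_const card_triangle.
    by rewrite sum1dep_card triangle_degree.
  by move=> d; rewrite /t andbCA.
have invA p : [pred p | flags p && g p] (face_step M p) =
              [pred p | flags p && g p] p.
  rewrite /= face_stepE corner_flags reverse_flags; case pF: (flags p) => //=.
  by rewrite gcor ?grev // flags_reverse.
have subA : {subset [pred p | flags p && g p] <= @flags G} by move=> p /andP[].
have := face_step_invariant_card subA invA.
have -> : #|[pred p | flags p && g p]| =
    #|[set d : G * G | adj d.1 d.2 && t d.1 d.2]| +
    2 * #|[set d : G * G | both d.1 d.2]|.
  rewrite -!sum1dep_card -sum1_card !big_mkcondr /=.
  rewrite (eq_big (fun p : flag => adj p.1.1 p.1.2 && true)
    (fun p => if g (p.1, p.2) then 1 else 0)).
  - rewrite -(pair_big (fun d => adj d.1 d.2) xpredT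
      (fun d s => if g (d, s) then 1 else 0)) /=.
    rewrite big_distrr -big_split /=; apply: eq_bigr => -[x y] /= xy.
    have := gopp (x, y, true) xy; rewrite big_bool /opposite /= => <-.
    by case: (g _); case: (g _).
  - by move=> p; rewrite andbT.
  - by case.
by rewrite card_t card_both; lia.
Qed.

End Quadrangulation.

(** * Wheels *)

Lemma val_iter_ordS (n : nat) (r : 'I_n) k : iter k (@ordS n) r = (r + k) %% n :> nat.
Proof.
elim: k => [|k IHk]; first by rewrite addn0 modn_small.
by rewrite /= IHk -addn1 modnDml addn1 addnS.
Qed.

Lemma iter_ordS_neq (n k : nat) (r : 'I_n) : 0 < k < n -> iter k (@ordS n) r != r.
Proof.
case/andP=> k0 kn; rewrite -val_eqE /= val_iter_ordS.
rewrite -{2}(modn_small (ltn_ord r)) -{2}[nat_of_ord r]addn0 eqn_modDl.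
by rewrite mod0n modn_small //; case: k k0 {kn}.
Qed.

Lemma ordS_neq (n : nat) (r : 'I_n) : 1 < n -> ordS r != r.
Proof. by move=> n1; apply: (@iter_ordS_neq n 1). Qed.

Section WheelTheory.

Variables (T : finType) (m : nat) (W : wheel T m).

Lemma hub_wverts : hub W \in wverts W.
Proof. by rewrite !inE eqxx. Qed.

Lemma rim_wverts r : rim W r \in wverts W.
Proof. by rewrite !inE imset_f ?orbT. Qed.

Lemma wvertsP x : x \in wverts W -> x = hub W \/ exists r, x = rim W r.
Proof.
by rewrite !inE => /orP[/eqP|/imsetP[r _ ->]]; [left | right; exists r].
Qed.

Lemma card_wverts : #|wverts W| = m.+1.
Proof.
rewrite cardsU1 card_imset ?card_ord; last exact: rim_inj.
by case: imsetP => // -[r _ /eqP]; rewrite eq_sym (negPf (hub_rim W r)).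
Qed.

Lemma wadj_sym : symmetric (wadj W).
Proof.
by move=> x y; congr (_ || _); apply: eq_existsb => r; rewrite orbC.
Qed.

Lemma wadj_spike r : wadj W (hub W) (rim W r).
Proof. by apply/orP; left; apply/existsP; exists r; rewrite !eqxx. Qed.

Lemma wadj_rim r : wadj W (rim W r) (rim W (ordS r)).
Proof. by apply/orP; right; apply/existsP; exists r; rewrite !eqxx. Qed.

Lemma wadjP x y : wadj W x y -> [/\ x \in wverts W, y \in wverts W & x != y].
Proof.
have hr := hub_rim W.
have m3 := wheel_ge3 W.
case/orP=> /existsP[r /orP[]/andP[/eqP-> /eqP->]]; split;
  rewrite ?hub_wverts ?rim_wverts // ?(inj_eq (@rim_inj _ _ W)) ?ordS_neq ?(ltnW m3) //.
- by rewrite eq_sym.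
- by rewrite eq_sym ordS_neq // ltnW.
Qed.

(** Indexing the rim by natural numbers from a base point r turns statements about
    distinct rim vertices into inequalities between numbers below m. *)
Definition rim_from (r : 'I_m) (k : nat) : T := rim W (iter k (@ordS m) r).

Lemma rim_from_eq r k l : (rim_from r k == rim_from r l) = (k == l %[mod m]).
Proof.
rewrite (inj_eq (@rim_inj _ _ W)) -val_eqE /= !val_iter_ordS.
exact: eqn_modDl.
Qed.

Lemma rim_from_neq r k l : k < m -> l < m -> k != l ->
  rim_from r k != rim_from r l.
Proof. by move=> km lm; rewrite rim_from_eq !modn_small. Qed.

Lemma rim_from_period r : rim_from r m = rim W r.
Proof. by apply/eqP; rewrite -[rim W r]/(rim_from r 0) rim_from_eq modnn mod0n. Qed.

Lemma rim_from_hub r k : rim_from r k != hub W.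
Proof. exact: hub_rim. Qed.

Lemma wadj_rim_from r k : wadj W (rim_from r k) (rim_from r k.+1).
Proof. exact: wadj_rim. Qed.

Lemma rim_edgeP x y : rim_edge W x y ->
  exists r, x = rim W r /\ (y = rim_from r 1 \/ y = rim_from r m.-1).
Proof.
have m3 := wheel_ge3 W.
case/existsP=> r /orP[]/andP[/eqP-> /eqP->]; first by exists r; split; last left.
exists (ordS r); split=> //; right; rewrite -[RHS]/(rim_from _ _).
rewrite /rim_from -iterSr prednK; last by lia.
by rewrite -[LHS]rim_from_period.
Qed.

Lemma rim_path_colouring (P : T -> bool) r k l :
  (forall i, k <= i < k + l -> P (rim_from r i) != P (rim_from r i.+1)) ->
  P (rim_from r (k + l)) = P (rim_from r k) (+) odd l.
Proof.
elim: l => [|l IHl] Pr; first by rewrite addn0 addbF.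
have := Pr (k + l); rewrite addnS ltnS leqnn leq_addr => /(_ isT).
rewrite IHl => [|i /andP[ki il]]; last by apply: Pr; rewrite ki addnS ltnW.
by rewrite /=; do 2 case: (P _); case: (odd l).
Qed.

(** If c is the hub, the odd rim remains; if not, a triangle at the hub does. *)
Lemma odd_wheel_minus_vertex (P : T -> bool) (c : T) :
  odd m ->
  (forall x y, wadj W x y -> x != c -> y != c -> P x != P y) -> False.
Proof.
move=> modd Pc; have m3 := wheel_ge3 W.
have r0 : 'I_m by apply: (@Ordinal _ 0); lia.
have [chub|chub] := eqVneq c (hub W).
  have /esym : P (rim_from r0 (0 + m)) = P (rim_from r0 0) (+) odd m.
    apply: rim_path_colouring => i _.
    by apply: Pc (wadj_rim_from _ _) _ _; rewrite chub rim_from_hub.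
  rewrite add0n rim_from_period modd addbT /rim_from /=.
  by case: (P _).
have [r [n1 n2]] : exists r, rim_from r 1 != c /\ rim_from r 2 != c.
  have [/existsP[r /eqP->]|/existsPn cr] := boolP [exists r, c == rim W r].
    by exists r; rewrite -[rim W r]/(rim_from r 0) !rim_from_neq //; lia.
  by exists r0; rewrite eq_sym (cr _) eq_sym (cr _).
have Pe := Pc _ _ (wadj_rim_from r 1) n1 n2.
have hc : hub W != c by rewrite eq_sym.
have := Pc _ _ (wadj_spike _) hc n1; have := Pc _ _ (wadj_spike _) hc n2.
by move: Pe; rewrite /rim_from /=; do 3 case: (P _).
Qed.

(** With at least five rim vertices, counting from the rim vertex c (or from one of
    the two chosen spikes), the second and third rim vertices avoid c and its rim
    neighbours.  The hub is among c, a, b in two of the three types, so the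
    triangle can meet them there; the disjunction covers all types, and either
    alternative keeps the edges of the triangle in a plane multiwheel. *)
Lemma chosen_pair_far_triangle c a b : odd m -> 3 < m -> chosen_pair W c a b ->
  exists x y, [/\ wadj W (hub W) x, wadj W x y, wadj W y (hub W) &
    let D := [set hub W; x; y] in
    (a \notin D) && (b \notin D) || (c \notin D) && ((a \notin D) || (b \notin D))].
Proof.
move=> modd m3 /andP[_ chosen].
suff [r Hr] : exists r, let D := [set hub W; rim_from r 2; rim_from r 3] in
    (a \notin D) && (b \notin D) || (c \notin D) && ((a \notin D) || (b \notin D)).
  exists (rim_from r 2), (rim_from r 3); split=> //; rewrite ?wadj_rim_from //.
    exact: wadj_spike.
  by rewrite wadj_sym; apply: wadj_spike.
have far r k : k \in [:: 0; 1; m.-1] ->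
    rim_from r k \notin [set hub W; rim_from r 2; rim_from r 3].
  rewrite !inE !negb_or rim_from_hub => /or3P[]/eqP-> /=;
    by rewrite !rim_from_neq //; lia.
have near x y : rim_edge W x y -> exists r,
    x \notin [set hub W; rim_from r 2; rim_from r 3] /\
    y \notin [set hub W; rim_from r 2; rim_from r 3].
  case/rim_edgeP=> r [-> [->|->]]; exists r; rewrite -[rim W r]/(rim_from r 0);
    by rewrite !far // !inE eqxx ?orbT.
case/or4P: chosen.
- by case/andP=> /near[r [cr ar]] _; exists r; rewrite /= cr ar orbT.
- by case/and4P=> _ _ _ /near[r [ar br]]; exists r; rewrite /= ar br.
- by case/andP=> _ /near[r [cr br]]; exists r; rewrite /= cr br !orbT.
- by case/andP=> /near[r [cr ar]] _; exists r; rewrite /= cr ar orbT.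
Qed.

Lemma chosen_pathP r r' h r'' : chosen_path W r r' h r'' ->
  exists2 t, r' = rim W t & h = hub W /\
  (r = rim_from t 1 /\ r'' = rim_from t m.-1 \/
   r'' = rim_from t 1 /\ r = rim_from t m.-1).
Proof.
case/and5P=> /eqP-> _ _ /rim_edgeP[t [-> t1]].
have rim_edge_sym x y : rim_edge W x y = rim_edge W y x.
  by apply: eq_existsb => s; rewrite orbC.
rewrite rim_edge_sym => /andP[/rim_edgeP[s [/rim_inj <-{s}]] t2 nr].
exists t => //; split=> //; move: t1 t2 nr.
by case=> -> [] ->; rewrite ?eqxx //; auto.
Qed.

(** The second and third vertices after r' on the rim, in either direction, are not
    on the chosen path when m is at least 5. *)
Lemma chosen_path_far_triangle r r' h r'' :
  odd m -> 3 < m -> chosen_path W r r' h r'' ->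
  exists x y, [/\ wadj W h x, wadj W x y, wadj W y h &
    [&& x \notin [:: r; r'; h; r''] & y \notin [:: r; r'; h; r'']]].
Proof.
move=> modd m3 /chosen_pathP[t -> [-> rr]].
exists (rim_from t 2), (rim_from t 3); rewrite wadj_rim_from wadj_spike.
rewrite wadj_sym wadj_spike; split=> //; rewrite -[rim W t]/(rim_from t 0).
rewrite !inE !negb_or !rim_from_hub.
by case: rr => -[-> ->]; rewrite !rim_from_neq //; lia.
Qed.

(** The rim path from r to r'' that avoids r' has m - 2 edges, an odd number. *)
Lemma chosen_path_colouring (P : T -> bool) r r' h r'' :
  odd m -> chosen_path W r r' h r'' ->
  (forall x y, wadj W x y -> x \notin [:: r'; h] -> y \notin [:: r'; h] ->
     P x != P y) ->
  P r != P r''.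
Proof.
move=> modd /chosen_pathP[t -> [-> rr]] Pe; have m3 := wheel_ge3 W.
have := @rim_path_colouring P t 1 m.-2.
have -> : 1 + m.-2 = m.-1 by lia.
have -> : odd m.-2 = true by lia.
move=> Prim; have {}Prim : P (rim_from t m.-1) = P (rim_from t 1) (+) true.
  apply: Prim => i im; apply: Pe (wadj_rim_from _ _) _ _;
  by rewrite !inE !negb_or rim_from_hub andbT -[rim W t]/(rim_from t 0)
     rim_from_neq //; lia.
by case: rr => -[-> ->]; rewrite Prim; case: (P _).
Qed.

(** In both directions of the chosen path, these two edges join the ends u_i and
    u_(i+1) of the middle spike to v_(i+1) and v_i, as in Mycielski's construction. *)
Lemma chosen_path_diagonals r r' h r'' : chosen_path W r r' h r'' ->
  wadj W r' r'' /\ wadj W h r.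
Proof.
move=> rr; split.
  by case/and5P: rr => _ _ _ e _; rewrite /wadj e orbT.
by case/chosen_pathP: rr => t _ [-> [[-> _]|[_ ->]]]; apply: wadj_spike.
Qed.

End WheelTheory.

Lemma wadj_K4 (T : finType) (m : nat) (W : wheel T m) x y : m = 3 ->
  wadj W x y = [&& x \in wverts W, y \in wverts W & x != y].
Proof.
move=> m3; apply/idP/idP => [/wadjP[-> -> ->]//|/and3P[]].
move=> /wvertsP[->|[r ->]] /wvertsP[->|[s ->]]; rewrite ?eqxx ?wadj_spike //.
  by rewrite wadj_sym wadj_spike.
rewrite (inj_eq (@rim_inj _ _ W)) => rs.
have [->|nrs] := eqVneq s (ordS r); first exact: wadj_rim.
rewrite wadj_sym; suff /eqP -> : r == ordS s by apply: wadj_rim.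
subst m; move: rs nrs; rewrite -!val_eqE /=.
by case: r s => [[|[|[|//]]] i] [[|[|[|//]]] j].
Qed.

Lemma is_edge_sum_single (G : sgraph) (I : finType) (V : I -> {set G})
    (E : I -> rel G) (i : I) x y :
  is_edge_sum V E -> E i x y -> (forall j, j != i -> ~~ E j x y) -> adj x y.
Proof.
move=> [_ ->] Ei Ej; rewrite (_ : [set j | _] = [set i]) ?cards1 //.
apply/setP=> j; rewrite !inE; have [->|ji] := eqVneq j i; first exact: Ei.
exact/negbTE/Ej.
Qed.

(** * Projective plane multiwheels *)

(** Two odd cycles of a projective quadrangulation meet; for a triangle and an
    arbitrary odd cycle, this says that no odd cycle survives the deletion of the
    triangle. *)
Lemma minus_triangle_bipartite (G : sgraph) (a b c : G) :
  quadrangulates_projective_plane G -> adj a b -> adj b c -> adj c a ->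
  exists P : G -> bool, forall x y, adj x y ->
    x \notin [set a; b; c] -> y \notin [set a; b; c] -> P x != P y.
Proof.
case=> M [planeM quadM] ab bc ca.
exact: (quadrangulation_minus_triangle_bipartite quadM planeM ab bc ca).
Qed.

Section Projective.

Variables (G : sgraph) (q : nat).
Local Notation k := q.*2.+1.
Variables (C : wheel G k) (m : 'I_k -> nat) (S : forall i, wheel G (m i)).
Variable (v : 'I_k -> G).
Hypothesis data : projective_multiwheel_data C S v.

Let u := rim C.

Let modd i : odd (m i). Proof. by case: data. Qed.

Let path_i i : chosen_path (S i) (v i) (u i) (u (ordS i)) (v (ordS i)) \/
               chosen_path (S i) (v (ordS i)) (u (ordS i)) (u i) (v i).
Proof. by case: data => _ H _ _ _; apply/orP. Qed.

Lemma uv_neq i j : u i != v j.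
Proof.
case: data => _ _; rewrite cons_uniq cat_uniq => /andP[_] /and3P[_ /hasPn uv _] _ _.
by apply: contraTneq (uv _ (codom_f v j)) => <-; rewrite negbK codom_f.
Qed.

Lemma v_inj : injective v.
Proof.
case: data => _ _; rewrite cons_uniq cat_uniq => /andP[_] /and3P[_ _ vU] _ _.
by apply/injectiveP.
Qed.

Lemma wverts_common i j : i != j ->
  (forall x, x \in wverts (S i) -> x \notin wverts (S j)) \/
  exists e, [/\ e \in [:: i; ordS i], e \in [:: j; ordS j] &
    forall x, x \in wverts (S i) -> x \in wverts (S j) -> x \in [:: u e; v e]].
Proof.
case: data => _ _ _ [+ _] _ => /(_ i j) /[apply] /setP SS.
move: SS; case: eqP => [->|_] SS.
  right; exists (ordS i); rewrite !inE !eqxx orbT; split=> // x xi xj.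
  by have := SS x; rewrite inE xi xj => /esym; rewrite !inE.
move: SS; case: eqP => [->|_] SS.
  right; exists (ordS j); rewrite !inE !eqxx orbT; split=> // x xi xj.
  by have := SS x; rewrite inE xi xj => /esym; rewrite !inE.
by left=> x xi; have := SS x; rewrite inE xi in_set0 => /= ->.
Qed.

(** Two distinct pieces share only an edge u_e v_e or an edge of the rim of C, so all
    other edges of a wheel lie in that wheel alone and survive in the sum. *)
Lemma projective_edge i x y : wadj (S i) x y ->
  (forall e, e \in [:: i; ordS i] -> ~~ ((x \in [:: u e; v e]) && (y \in [:: u e; v e]))) ->
  ~~ ((x \in [:: u i; u (ordS i)]) && (y \in [:: u i; u (ordS i)])) ->
  adj x y.
Proof.
move=> xy nuv nuu; have [xi yi nxy] := wadjP xy.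
case: data => _ _ _ [_ SC] edges_sum.
apply: (is_edge_sum_single (i := Some i) edges_sum) => //= -[j|] ji.
  apply/negP=> /wadjP[xj yj _]; have ij : i != j.
    by apply: contraNneq ji => ->.
  have [/(_ x xi)|[e [ei _ Se]]] := wverts_common ij; first by rewrite xj.
  by have := nuv e ei; rewrite !Se.
apply: contra nuu => /wadjP[xC yC _]; have /setP SCi := SC i.
have := SCi x; have := SCi y; rewrite !in_setI xi yi xC yC !in_set2 !inE.
by move=> <- <-.
Qed.

Lemma ordS_k_neq (i : 'I_k) : ordS i != i.
Proof. by apply: ordS_neq; have := wheel_ge3 C; lia. Qed.

Lemma u_inj : injective u.
Proof. exact: rim_inj. Qed.

Lemma projective_diagonal i : adj (u i) (v (ordS i)) /\ adj (u (ordS i)) (v i).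
Proof.
have vu j l : v j == u l = false by rewrite eq_sym (negPf (uv_neq _ _)).
have uv j l : u j == v l = false by rewrite (negPf (uv_neq _ _)).
have wu : wadj (S i) (u i) (v (ordS i)) /\ wadj (S i) (u (ordS i)) (v i).
  by case: (path_i i) => /chosen_path_diagonals[].
have [w1 w2] := wu; have nS := ordS_k_neq i.
split; [apply: projective_edge w1 _ _ | apply: projective_edge w2 _ _] => *;
  rewrite !inE ?uv ?vu ?(inj_eq u_inj) ?(inj_eq v_inj) ?orbF ?andbF //;
  apply/negP=> /andP[/eqP <-]; by rewrite ?(negPf nS) // eq_sym ?(negPf nS).
Qed.

Section LargeWheel.

Variable i : 'I_k.
Hypothesis mi : 3 < m i.
Hypothesis qpp : quadrangulates_projective_plane G.

Lemma corners_wverts j : [/\ u j \in wverts (S j), u (ordS j) \in wverts (S j),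
  v j \in wverts (S j) & v (ordS j) \in wverts (S j)].
Proof.
by case: (path_i j) => /chosen_path_diagonals[/wadjP[? ? _] /wadjP[? ? _]].
Qed.

Lemma projective_far_triangle :
  exists h x y, [/\ [\/ h = u i | h = u (ordS i)],
    adj h x /\ adj x y /\ adj y h,
    x \in wverts (S i) /\ y \in wverts (S i) &
    forall z, z \in [:: x; y] -> z \notin [:: u i; v i; u (ordS i); v (ordS i)]].
Proof.
suff [h [x [y [hu hx xy yh far]]]] : exists h x y, [/\ [\/ h = u i | h = u (ordS i)],
    wadj (S i) h x, wadj (S i) x y, wadj (S i) y h &
    forall z, z \in [:: x; y] -> z \notin [:: u i; v i; u (ordS i); v (ordS i)]].
  have [xi yi _] := wadjP xy; exists h, x, y.
  have off z : z \in [:: x; y] -> forall t, wadj (S i) t z -> adj t z.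
    move=> zxy t tz; have := far z zxy; have [ti zi ntz] := wadjP tz.
    rewrite !inE !negb_or => /and4P[/negPf zu /negPf zv /negPf zu' /negPf zv'].
    apply: projective_edge tz _ _ => [e|]; last by rewrite !inE zu zu' andbF.
    by rewrite !inE => /orP[]/eqP->; rewrite ?zu ?zv ?zu' ?zv' andbF.
  split=> //; split; first by rewrite off // !inE eqxx.
  split; first by rewrite off // !inE eqxx orbT.
  by rewrite adj_sym; apply: (off y); [rewrite !inE eqxx orbT | rewrite wadj_sym].
case: (path_i i) => pth; have [x [y [hx xy yh /andP[nx ny]]]] :=
  chosen_path_far_triangle (modd i) mi pth.
  exists (u (ordS i)), x, y; split=> // [|z]; first by right.
  move: nx ny; rewrite !inE => nx ny /orP[]/eqP->.
    by move: nx; rewrite !negb_or => /and4P[-> -> -> ->].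
  by move: ny; rewrite !negb_or => /and4P[-> -> -> ->].
exists (u i), x, y; split=> // [|z]; first by left.
move: nx ny; rewrite !inE => nx ny /orP[]/eqP->.
  by move: nx; rewrite !negb_or => /and4P[-> -> -> ->].
by move: ny; rewrite !negb_or => /and4P[-> -> -> ->].
Qed.

(** In a 2-colouring off the far triangle, the colours of the v_j alternate along
    all wheels except S_i.  The triangle meets only one of u_i, u_(i+1); the other
    one closes the walk: u_i has the neighbours v_(i-1) and v_(i+1), and
    u_(i+1) has the neighbours v_i and v_(i+2), at an odd number of steps from
    each other in both cases. *)
Lemma no_large_wheel : False.
Proof.
have [h [x [y [hu [hx [xy yh]] [xi yi] far]]]] := projective_far_triangle.
have [P Pe] := minus_triangle_bipartite qpp hx xy yh.
have k3 : 2 < k := wheel_ge3 C.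
have hv j : h != v j by case: hu => ->; apply: uv_neq.
have offT j z : z \in wverts (S j) -> z != h ->
    (j = i -> z \in [:: u i; v i; u (ordS i); v (ordS i)]) ->
    z \notin [set h; x; y].
  move=> zj zh zc; rewrite !inE (negPf zh) /=; apply/negP=> zxy.
  have zxy' : z \in [:: x; y] by rewrite !inE.
  have zi : z \in wverts (S i) by case/orP: zxy => /eqP->.
  have := far z zxy'; have [/esym/zc -> //|/negPf ij] := eqVneq i j.
  have [/(_ z zi)/negP//|[e [ei _ Se]]] := wverts_common (negbT ij).
  move/negP; apply; have := Se z zi zj; rewrite !inE.
  by move: ei; rewrite !inE => /orP[]/eqP-> /orP[]->; rewrite ?orbT.
have vT j : v j \notin [set h; x; y].
  have [_ _ vj _] := corners_wverts j.
  by apply: offT vj _ _ => [|->]; rewrite 1?eq_sym // !inE eqxx orbT.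
have step j : j != i -> P (v j) != P (v (ordS j)).
  move=> ji.
  suff off a b : wadj (S j) a b -> a \notin [:: u j; u (ordS j)] ->
      b \notin [:: u j; u (ordS j)] -> P a != P b.
    case: (path_i j) => pth.
      by apply: (chosen_path_colouring (modd j) pth).
    rewrite eq_sym; apply: (chosen_path_colouring (modd j) pth) => a b ab na nb.
    by apply: off ab _ _; rewrite mem_seq2 orbC -mem_seq2.
  have nh z : z \in wverts (S j) -> z \notin [:: u j; u (ordS j)] -> z != h.
    move=> zj; apply: contraNneq => zh; have hi : z \in wverts (S i).
      by have [ui ui' _ _] := corners_wverts i; rewrite zh; case: hu => ->.
    have [/(_ z zj)/negP//|[e [ej _ Se]]] := wverts_common ji.
    have := Se z zj hi; rewrite !inE {2}zh (negPf (hv e)) orbF => /eqP->.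
    by move: ej; rewrite !inE => /orP[]/eqP->; rewrite eqxx ?orbT.
  move=> ab na nb; have [aj bj nab] := wadjP ab.
  have ji' : j = i -> forall z, z \in [:: u i; v i; u (ordS i); v (ordS i)].
    by move=> e; rewrite e eqxx in ji.
  apply: Pe; last 2 first.
  - by apply: offT aj (nh _ aj na) _ => /ji'.
  - by apply: offT bj (nh _ bj nb) _ => /ji'.
  apply: projective_edge ab _ _; last by rewrite (negPf na).
  move=> e ej; apply/negP=> /andP[]; rewrite !inE.
  have nu z : z \notin [:: u j; u (ordS j)] -> (z == u e) = false.
    apply: contraNF => /eqP->.
    by move: ej; rewrite !inE => /orP[]/eqP->; rewrite eqxx ?orbT.
  by rewrite !nu //= => /eqP ae /eqP be; rewrite ae be eqxx in nab.
have walk l : l < k -> P (v (iter l (@ordS k) (ordS i))) = P (v (ordS i)) (+) odd l.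
  elim: l => [|l IHl] lk; first by rewrite addbF.
  have ne : iter l (@ordS k) (ordS i) != i.
    by rewrite -iterSr; apply: iter_ordS_neq.
  have := step _ ne; rewrite IHl; last by lia.
  by rewrite /=; do 2 case: (P _); case: (odd l).
have period : iter k (@ordS k) i = i.
  by apply: ord_inj; rewrite val_iter_ordS modnDr modn_small.
have Padj s t : s != h -> s \in [:: u i; u (ordS i)] -> adj s (v t) -> P s != P (v t).
  move=> sh su st; apply: Pe st _ (vT t).
  have [ui ui' _ _] := corners_wverts i.
  apply: (offT i) sh _ => [|_].
    by move: su; rewrite mem_seq2 => /orP[]/eqP->.
  by move: su; rewrite !inE => /orP[]->; rewrite ?orbT.
have neuu : u (ordS i) != u i by rewrite (inj_eq u_inj) ordS_k_neq.
case: hu => hu'.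
- have [d1 _] := projective_diagonal (ordS i); have [_ d2] := projective_diagonal i.
  have := Padj (u (ordS i)) _ _ _ d1; have := Padj (u (ordS i)) _ _ _ d2.
  rewrite hu' neuu !inE eqxx orbT => /(_ isT isT) + /(_ isT isT).
  have := walk 1; rewrite /= => -> //; last by lia.
  have := walk q.*2; rewrite -iterSr period odd_double => -> //.
  by do 2 case: (P _).
pose j := iter q.*2.-1 (@ordS k) (ordS i).
have ji : ordS j = i.
  by rewrite -iterS prednK -?iterSr //; lia.
have [_ d1] := projective_diagonal j; have [d2 _] := projective_diagonal i.
rewrite ji in d1.
have := Padj (u i) _ _ _ d1; have := Padj (u i) _ _ _ d2.
rewrite hu' eq_sym neuu !inE eqxx => /(_ isT isT) + /(_ isT isT).
rewrite walk; last by lia.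
have -> : odd q.*2.-1 by lia.
by do 2 case: (P _).
Qed.

End LargeWheel.

Lemma projective_wheels_are_K4 :
  quadrangulates_projective_plane G -> forall i, m i = 3.
Proof.
move=> qpp i; apply/eqP; rewrite eqn_leq (wheel_ge3 (S i)) andbT leqNgt.
by apply/negP=> mi; exact: no_large_wheel mi qpp.
Qed.

End Projective.

(** * Plane multiwheels *)

Lemma chosen_pair_wadj (T : finType) (m : nat) (W : wheel T m) c a b :
  chosen_pair W c a b -> [/\ wadj W c a, wadj W c b & a != b].
Proof.
rewrite /wadj => /andP[ab]; case/or4P.
- by case/andP=> -> ->; rewrite !orbT.
- by case/and4P=> _ -> ->.
- by case/andP=> -> ->; rewrite orbT.
- by case/andP=> -> ->; rewrite orbT.
Qed.

Section Plane.

Variables (G : sgraph) (k : nat) (m : 'I_k -> nat).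
Variables (S : forall i, wheel G (m i)) (c : G) (d : 'I_k -> G).
Hypotheses (k3 : 2 < k) (modd : forall i, odd (m i)).
Hypothesis pair_i : forall i, chosen_pair (S i) c (d i) (d (ordS i)).
Hypothesis common : forall i j, i != j -> wverts (S i) :&: wverts (S j) =
  if j == ordS i then [set c; d j]
  else if i == ordS j then [set c; d i] else [set c].
Hypothesis edge_sum : is_edge_sum (fun i => wverts (S i)) (fun i => wadj (S i)).
Hypothesis qpp : quadrangulates_projective_plane G.

Lemma plane_common i j : i != j -> exists2 e, e \in [:: i; ordS i] &
  forall x, x \in wverts (S i) -> x \in wverts (S j) -> x \in [:: c; d e].
Proof.
move=> /common/setP SS; move: SS; case: eqP => [->|_] SS.
  exists (ordS i); first by rewrite mem_seq2 eqxx orbT.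
  by move=> x xi xj; have := SS x; rewrite inE xi xj in_set2 mem_seq2.
exists i; first by rewrite mem_seq2 eqxx.
move=> x xi xj; have := SS x; rewrite inE xi xj mem_seq2.
by case: ifP => _; rewrite ?in_set2 ?in_set1 => <-.
Qed.

Lemma plane_next i j x : j = ordS i ->
  x \in wverts (S i) -> x \in wverts (S j) -> x \in [:: c; d j].
Proof.
move=> ji xi xj; have ij : i != j by rewrite ji eq_sym ordS_neq // ltnW.
have /setP/(_ x) := common ij.
by rewrite ji eqxx -ji inE xi xj in_set2 mem_seq2.
Qed.

(** Two distinct wheels share only c, or c and some d_e, so that an edge avoiding
    c, or avoiding both d_i and d_(i+1), lies in the wheel S_i alone. *)
Lemma plane_edge i x y : wadj (S i) x y ->
  (x != c) && (y != c) \/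
    (x \notin [:: d i; d (ordS i)]) && (y \notin [:: d i; d (ordS i)]) ->
  adj x y.
Proof.
move=> xy off; have [xi yi nxy] := wadjP xy.
apply: (is_edge_sum_single edge_sum xy) => j ji; apply/negP=> /wadjP[xj yj _].
have [|e ei Se] := @plane_common i j; first by rewrite eq_sym.
move: (Se x xi xj) (Se y yi yj); rewrite !mem_seq2.
case: off => /andP[nx ny].
  by rewrite (negPf nx) (negPf ny) => /eqP xe /eqP ye; rewrite xe ye eqxx in nxy.
have nd z : z \notin [:: d i; d (ordS i)] -> (z == d e) = false.
  apply: contraNF => /eqP->.
  by move: ei; rewrite !mem_seq2 => /orP[]/eqP->; rewrite eqxx ?orbT.
by rewrite !nd // !orbF => /eqP xe /eqP ye; rewrite xe ye eqxx in nxy.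
Qed.

(** An odd wheel minus the vertex c still contains an odd cycle, which would be
    disjoint from the triangle. *)
Lemma triangle_vs_wheel i j a b e :
  i != j -> adj a b -> adj b e -> adj e a ->
  [set a; b; e] \subset wverts (S i) ->
  (forall x, x \in [set a; b; e] -> x \in wverts (S j) -> x = c) -> False.
Proof.
move=> ij ab be ea Ti Tj.
have [P Pe] := minus_triangle_bipartite qpp ab be ea.
apply: (@odd_wheel_minus_vertex _ _ (S j) P c (modd j)) => x y xy xc yc.
have [xj yj _] := wadjP xy; apply: Pe.
- by apply: plane_edge xy _; left; rewrite xc yc.
- by apply: contraNN xc => /Tj/(_ xj)/eqP.
- by apply: contraNN yc => /Tj/(_ yj)/eqP.
Qed.

(** The far triangle of a large wheel misses d_i or d_(i+1); the neighbouring wheel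
    on that side meets the triangle at most in c. *)
Lemma plane_wheels_are_K4 i : m i = 3.
Proof.
apply/eqP; rewrite eqn_leq (wheel_ge3 (S i)) andbT leqNgt; apply/negP=> m3.
have [x [y [hx xy yh]]] := chosen_pair_far_triangle (modd i) m3 (pair_i i).
set h := hub (S i) in hx yh *; set D := [set h; x; y] => /= far.
have Ti : D \subset wverts (S i).
  have [? ? _] := wadjP hx; have [_ ? _] := wadjP xy.
  by apply/subsetP=> z /setUP[/set2P[]->|/set1P->].
have [DD hD [xD yD]] : [/\ forall s t, wadj (S i) s t -> s \in D -> t \in D -> adj s t,
    h \in D & x \in D /\ y \in D].
  rewrite !inE !eqxx !orbT; split=> // s t st sD tD; apply: plane_edge st _.
  have nD r z : r \notin D -> z \in D -> z != r.
    by move=> rD zD; apply: contraNneq rD => <-.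
  by case/orP: far => /andP[n1 n2]; [right|left];
    rewrite ?mem_seq2 ?negb_or ?(nD _ _ n1) ?(nD _ _ n2).
have nS (e : 'I_k) : ordS e != e by rewrite ordS_neq // ltnW.
have [j [e [ij eT Se]]] : exists j e, [/\ i != j, d e \notin D &
    forall z, z \in wverts (S i) -> z \in wverts (S j) -> z \in [:: c; d e]].
  suff [nd|nd] : d (ordS i) \notin D \/ d i \notin D.
  - exists (ordS i), (ordS i); split=> // [|z]; [by rewrite eq_sym | exact: plane_next].
  - exists (ord_pred i), i; split=> // [|z zi zj].
      by rewrite -{1}[i]ord_predK.
    by apply: plane_next zj zi; rewrite ord_predK.
  by case/orP: far => /andP[n1 n2]; [left | case/orP: n2; auto].
apply: (triangle_vs_wheel ij (DD _ _ hx hD xD) (DD _ _ xy xD yD) (DD _ _ yh yD hD) Ti).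
move=> z zD zj; have := Se z (subsetP Ti z zD) zj; rewrite mem_seq2 => /orP[/eqP//|/eqP zd].
by rewrite zd in zD; rewrite zD in eT.
Qed.

(** A K4 with the three vertices c, d_i, d_(i+1) has one more vertex; the three
    types of chosen pairs then give the same graph. *)
Lemma plane_apex i : exists x, wverts (S i) = [set c; d i; d (ordS i); x] /\
  uniq [:: c; d i; d (ordS i); x].
Proof.
have mi := plane_wheels_are_K4 i.
have [/wadjP[cS dS cd] /wadjP[_ dS' cd'] dd] := chosen_pair_wadj (pair_i i).
have sub : [set c; d i; d (ordS i)] \subset wverts (S i).
  by apply/subsetP=> z /setUP[/set2P[]->|/set1P->].
have : #|wverts (S i) :\: [set c; d i; d (ordS i)]| == 1.
  rewrite cardsDS // card_wverts mi.
  have -> : [set c; d i; d (ordS i)] = [set z in [:: c; d i; d (ordS i)]].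
    by apply/setP=> z; rewrite !inE orbA.
  rewrite cardsE (card_uniqP _) //.
  by rewrite /= !inE negb_or cd cd' dd.
case/cards1P=> x /setP xE; exists x; split.
  apply/setP=> z; rewrite [RHS]in_setU -(xE z) in_setD.
  by case zD: (z \in [set c; d i; d (ordS i)]) => //=; rewrite (subsetP sub).
have := xE x; rewrite in_setD in_set1 eqxx !in_setU !in_set1 !negb_or.
rewrite /= !inE !negb_or cd cd' dd => /andP[/andP[/andP[n1 n2] n3] _].
by rewrite !(eq_sym _ x) n1 n2 n3.
Qed.

(** With at least four wheels, the wheels numbered 0 and 2 share only c, and the
    first of them has a triangle without c. *)
Lemma plane_three_wheels : k = 3.
Proof.
apply/eqP; rewrite eqn_leq k3 andbT leqNgt; apply/negP=> k4.
have k0 : 0 < k by lia.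
have k2 : 2 < k by [].
pose i := Ordinal k0; pose j := Ordinal k2.
have ij : i != j by [].
have [x [Vi xU]] := plane_apex i.
have mi := plane_wheels_are_K4 i.
have Vc := common ij.
have jS : (j == ordS i) = false by rewrite -val_eqE /= modn_small // ltnW.
have iS : (i == ordS j) = false by rewrite -val_eqE /= modn_small.
rewrite {}jS {}iS in Vc.
move: xU; rewrite /= !inE !negb_or andbT => /and3P[/and3P[n1 n2 n3] /andP[n4 n5] n6].
have sub : [set d i; d (ordS i); x] \subset wverts (S i).
  by rewrite Vi; apply/subsetP=> z; rewrite !inE; case: (z == c) => //=; rewrite -!orbA.
have nc z : z \in [set d i; d (ordS i); x] -> z != c.
  by rewrite !inE -!orbA => /or3P[]/eqP->; rewrite eq_sym.
have adjT s t : s \in [set d i; d (ordS i); x] -> t \in [set d i; d (ordS i); x] ->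
    s != t -> adj s t.
  move=> sT tT st; apply: (@plane_edge i); last by left; rewrite !nc.
  by rewrite (wadj_K4 _ _ _ mi) !(subsetP sub).
apply: (triangle_vs_wheel ij _ _ _ sub).
- by apply: adjT => //; rewrite !inE eqxx ?orbT.
- by apply: adjT => //; rewrite !inE eqxx ?orbT.
- by apply: adjT; [rewrite !inE eqxx ?orbT | rewrite !inE eqxx | rewrite eq_sym].
move=> z /(subsetP sub) zi zj; have /setP/(_ z) := Vc.
by rewrite in_setI zi zj in_set1 => /esym/eqP.
Qed.

End Plane.

(** * The Mycielski graph of a triangle *)

Lemma odd_card_ord3 (F : 'I_3 -> bool) (i0 i1 i2 : 'I_3) :
  i0 = 0 :> nat -> i1 = 1 :> nat -> i2 = 2 :> nat ->
  odd #|[set i | F i]| = F i0 (+) F i1 (+) F i2.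
Proof.
move=> e0 e1 e2; rewrite -sum1dep_card big_mkcond !big_ord_recl big_ord0 /=.
have -> : i0 = ord0 by apply: ord_inj.
have -> : i1 = lift ord0 ord0 by apply: ord_inj.
have -> : i2 = lift ord0 (lift ord0 ord0) by apply: ord_inj.
by do 3 case: (F _).
Qed.

Lemma odd_card_option (I : finType) (F : option I -> bool) :
  odd #|[set o | F o]| = F None (+) odd #|[set i | F (Some i)]|.
Proof.
rewrite (cardsD1 None) inE oddD oddb; congr (_ (+) odd _).
rewrite -[RHS](card_imset _ (fun i j => @Some_inj _ i j)).
apply: eq_card => -[i|]; rewrite !inE /=.
  by rewrite mem_imset ?inE // => ? ? [].
by apply/esym/imsetP=> -[].
Qed.

Lemma codom_ord3 (T : Type) (f : 'I_3 -> T) (i0 i1 i2 : 'I_3) :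
  i0 = 0 :> nat -> i1 = 1 :> nat -> i2 = 2 :> nat ->
  codom f = [:: f i0; f i1; f i2].
Proof.
move=> e0 e1 e2.
have -> : i0 = ord0 by apply: ord_inj.
have -> : i1 = lift ord0 ord0 by apply: ord_inj.
have -> : i2 = lift ord0 (lift ord0 ord0) by apply: ord_inj.
by rewrite codomE !enum_ordSl enum_ord0.
Qed.

Lemma K4_chosen_path (T : finType) (W : wheel T 3) (i0 i1 i2 : 'I_3) :
  i0 = 0 :> nat -> i1 = 1 :> nat -> i2 = 2 :> nat ->
  chosen_path W (rim W i0) (rim W i1) (hub W) (rim W i2).
Proof.
move=> e0 e1 e2.
have spk r : spike W (hub W) (rim W r) by apply/existsP; exists r; rewrite !eqxx.
have rimE r s : s = ordS r -> rim_edge W (rim W r) (rim W s).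
  by move=> ->; apply/existsP; exists r; rewrite !eqxx.
rewrite /chosen_path eqxx !spk !rimE ?(inj_eq (@rim_inj _ _ W)) -?val_eqE /= ?e0 ?e2 //.
  by apply: ord_inj; rewrite /= e0 e1.
by apply: ord_inj; rewrite /= e1 e2.
Qed.

Section MycielskiTriangle.

Variables (G : sgraph) (w : nat -> G).
Hypothesis w_eq : forall a b, a < 7 -> b < 7 -> (w a == w b) = (a == b).
Hypothesis w_surj : forall y, exists2 n, n < 7 & y = w n.

(** The vertices of the graph are numbered c = 0, d_i = 1 + i, and 4 + i for the
    fourth vertex of the K4 with vertices c, d_i, d_(i+1); this lists the numbers in
    the i-th K4. *)
Definition piece (i : nat) := nth [::] [:: [:: 0; 1; 2; 4]; [:: 0; 2; 3; 5]; [:: 0; 3; 1; 6]] i.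

Hypothesis adj_w : forall a b, a < 7 -> b < 7 ->
  adj (w a) (w b) = odd #|[set i : 'I_3 | [&& a \in piece i, b \in piece i & a != b]]|.

Lemma K4_wheel (h : nat) (rs : seq nat) :
  uniq (h :: rs) -> all (gtn 7) (h :: rs) -> size rs = 3 ->
  {W : wheel G 3 | hub W = w h /\ (forall r, rim W r = w (nth 0 rs r)) &
    forall n, n < 7 -> (w n \in wverts W) = (n \in h :: rs)}.
Proof.
move=> /andP[hrs rsU] /andP[h7 /allP rs7] rs3.
have nth7 (r : 'I_3) : nth 0 rs r < 7 by apply: rs7; rewrite mem_nth // rs3.
have rim_inj : injective (fun r : 'I_3 => w (nth 0 rs r)).
  by move=> r s /eqP; rewrite w_eq // nth_uniq ?rs3 // => /eqP/ord_inj.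
have hub_rim (r : 'I_3) : w (nth 0 rs r) != w h.
  by rewrite w_eq //; apply: contraNneq hrs => <-; rewrite mem_nth // rs3.
exists (Wheel (isT : 2 < 3) rim_inj hub_rim) => // n n7.
rewrite /wverts !inE /= w_eq //; congr (_ || _); apply/imsetP/idP => [[r _ /eqP]|nrs].
  by rewrite w_eq // => /eqP->; rewrite mem_nth // rs3.
have n3 : index n rs < 3 by rewrite -rs3 index_mem.
by exists (Ordinal n3); rewrite //= nth_index.
Qed.

(** Each d_i becomes the vertex v_i, and u_i must be adjacent to v_(i-1) and v_(i+1),
    whence it is the fourth vertex of the K4 that contains d_(i+1) and d_(i+2). *)
Definition u_code (i : nat) := nth 0 [:: 5; 6; 4] i.
Definition quad_hub (i : nat) := nth 0 [:: 6; 4; 5] i.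
Definition quad_rim (i : nat) := [:: i.+1; u_code i; nth 0 [:: 2; 3; 1] i].

(** In the edge sum of C, with hub c, and the three K4s on v_i, u_i, u_(i+1),
    v_(i+1), the edges u_i u_(i+1) and u_i v_i occur twice; what remains is the
    edge sum of the three old K4s.  With all vertices numbered, each condition is a finite
    computation. *)
Lemma mycielski_triangle_grotzsch : grotzsch_class G.
Proof.
have [C [hubC rimC] vertsC] := @K4_wheel 0 [:: 5; 6; 4] isT isT (erefl _).
have SU (i : 'I_3) : uniq (quad_hub i :: quad_rim i) by case: i => [[|[|[|]]]].
have S7 (i : 'I_3) : all (gtn 7) (quad_hub i :: quad_rim i) by case: i => [[|[|[|]]]].
pose Sx i := K4_wheel (SU i) (S7 i) (erefl _).
pose S i : wheel G 3 := s2val (Sx i).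
have hubS i : hub (S i) = w (quad_hub i) by case: (s2valP (Sx i)).
have rimS i r : rim (S i) r = w (nth 0 (quad_rim i) r) by case: (s2valP (Sx i)).
have vertsS i n : n < 7 -> (w n \in wverts (S i)) = (n \in quad_hub i :: quad_rim i).
  exact: (s2valP' (Sx i)).
pose v (i : 'I_3) := w i.+1.
pose o0 : 'I_3 := @Ordinal 3 0 isT.
pose o1 : 'I_3 := @Ordinal 3 1 isT.
pose o2 : 'I_3 := @Ordinal 3 2 isT.
exists 1, C, (fun _ => 3), S, v; split=> //; split.
- by [].
- move=> i; apply/orP; left.
  have := @K4_chosen_path _ (S i) o0 o1 o2 erefl erefl erefl.
  rewrite hubS !rimS !rimC /v /=.
  by case: i => [[|[|[|//]]] ilt].
- rewrite hubC !(@codom_ord3 _ _ o0 o1 o2) // !rimC /v /=.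
  change (uniq (map w [:: 0; 5; 6; 4; 1; 2; 3])).
  have lt7 : all (gtn 7) [:: 0; 5; 6; 4; 1; 2; 3] by [].
  rewrite map_inj_in_uniq // => a b /(allP lt7) a7.
  by move=> /(allP lt7) b7 /eqP; rewrite w_eq // => /eqP.
- have u7 i : u_code i < 7 by case: i => [|[|[|i]]]; rewrite /u_code /= ?nth_nil.
  have rimC' i : rim C i = w (u_code i) by rewrite rimC.
  have v7 (i : 'I_3) : i.+1 < 7 by case: i => [[|[|[|]]]].
  split=> [i j ij|i]; apply/setP=> y; have [n n7 ->] := w_surj y.
    rewrite in_setI !vertsS //.
    have -> : (w n \in if j == ordS i then [set rim C j; v j]
        else if i == ordS j then [set rim C i; v i] else set0) =
      if j == ordS i then (n == u_code j) || (n == j.+1)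
        else if i == ordS j then (n == u_code i) || (n == i.+1) else false.
      case: ifP => _; first by rewrite in_set2 rimC' !w_eq.
      by case: ifP => _; rewrite ?in_set0 // in_set2 rimC' !w_eq.
    rewrite -!val_eqE /= in ij *.
    case: i ij => [[|[|[|//]]] ?] /=; case: j => [[|[|[|//]]] ?] //= _;
      by case: n n7 => [|[|[|[|[|[|[|//]]]]]]].
  rewrite in_setI vertsS // vertsC // in_set2 !rimC' !w_eq //.
  by case: i => [[|[|[|//]]] ?]; case: n n7 => [|[|[|[|[|[|[|//]]]]]]].
split.
  apply/setP=> y; rewrite in_setT; have [n n7 ->] := w_surj y; apply/bigcupP.
  exists (nth None [:: None; Some o0; Some o1; Some o2] n) => //.
  case: n n7 => [|[|[|[|[|[|[|//]]]]]]] _ /=; by rewrite ?vertsS ?vertsC.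
move=> x y; have [a a7 ->] := w_surj x; have [b b7 ->] := w_surj y.
rewrite adj_w // odd_card_option !(@odd_card_ord3 _ o0 o1 o2) //.
rewrite !(wadj_K4 _ _ _ erefl) !vertsS // !vertsC // w_eq //.
case: a a7 => [|[|[|[|[|[|[|//]]]]]]] _;
  by case: b b7 => [|[|[|[|[|[|[|//]]]]]]].
Qed.

End MycielskiTriangle.

(** * The conclusion *)

Section PlaneToGrotzsch.

Variables (G : sgraph) (m : 'I_3 -> nat).
Variables (S : forall i, wheel G (m i)) (c : G) (d : 'I_3 -> G).
Hypothesis modd : forall i, odd (m i).
Hypothesis pair_i : forall i, chosen_pair (S i) c (d i) (d (ordS i)).
Hypothesis common : forall i j, i != j -> wverts (S i) :&: wverts (S j) =
  if j == ordS i then [set c; d j]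
  else if i == ordS j then [set c; d i] else [set c].
Hypothesis edge_sum : is_edge_sum (fun i => wverts (S i)) (fun i => wadj (S i)).
Hypothesis qpp : quadrangulates_projective_plane G.

(** The seven vertices are distinct because a fourth vertex lies in its own K4
    only. *)
Lemma plane_grotzsch : grotzsch_class G.
Proof.
have apex := plane_apex (isT : 2 < 3) modd pair_i common edge_sum qpp.
have {apex} [x xP] := fin_all_exists apex.
have V i : wverts (S i) = [set c; d i; d (ordS i); x i] by case: (xP i).
have mi := plane_wheels_are_K4 (isT : 2 < 3) modd pair_i common edge_sum qpp.
have neq i : [/\ c != d i, c != x i, d i != d (ordS i), d i != x i & d (ordS i) != x i].
  case: (xP i) => _; rewrite /= !inE !negb_or !andbT.
  by case/and3P=> /and3P[-> _ ->] /andP[-> ->] ->.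
have xS i j : i != j -> x i \notin wverts (S j).
  move=> ij; apply/negP=> xj; have [e ei Se] := plane_common common ij.
  have xi : x i \in wverts (S i) by rewrite V !inE eqxx orbT.
  have [_ cx _ dx dx'] := neq i; have := Se _ xi xj.
  rewrite mem_seq2 eq_sym (negPf cx) => /eqP xe.
  move: ei; rewrite mem_seq2 => /orP[]/eqP ee; rewrite xe ee eqxx // in dx dx'.
have dx i j : d i != x j.
  have [->|ij] := eqVneq i j; first by case: (neq j).
  have := xS j i; rewrite eq_sym => /(_ ij); apply: contraNneq => <-.
  by rewrite V !inE eqxx orbT.
have xx i j : i != j -> x i != x j.
  move=> /xS; apply: contraNneq => ->.
  by rewrite V !inE eqxx !orbT.
pose o0 : 'I_3 := @Ordinal 3 0 isT.
pose o1 : 'I_3 := @Ordinal 3 1 isT.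
pose o2 : 'I_3 := @Ordinal 3 2 isT.
have s0 : ordS o0 = o1 by apply: ord_inj.
have s1 : ordS o1 = o2 by apply: ord_inj.
have s2 : ordS o2 = o0 by apply: ord_inj.
have dd0 : d o0 != d o1 by rewrite -s0; case: (neq o0).
have dd1 : d o1 != d o2 by rewrite -s1; case: (neq o1).
have dd2 : d o2 != d o0 by rewrite -s2; case: (neq o2).
pose ws := [:: c; d o0; d o1; d o2; x o0; x o1; x o2].
have cd i : c != d i by case: (neq i).
have cx i : c != x i by case: (neq i).
have wsU : uniq ws.
  by rewrite /= !inE !negb_or !cd !cx !dx dd0 dd1 eq_sym dd2 !xx.
pose w := nth c ws.
have w_eq a b : a < 7 -> b < 7 -> (w a == w b) = (a == b).
  by move=> a7 b7; apply: nth_uniq.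
have [cover adjE] := edge_sum.
have o3 i : [\/ i = o0, i = o1 | i = o2].
  by case: i => [[|[|[|//]]] ?]; [constructor 1|constructor 2|constructor 3]; apply: ord_inj.
apply: (@mycielski_triangle_grotzsch G w) => [//|y|a b a7 b7].
  have : y \in ws.
    have : y \in [set: G] by [].
    rewrite -cover => /bigcupP[i _]; rewrite V !inE.
    by case: (o3 i) => ->; rewrite ?s0 ?s1 ?s2 -!orbA =>
      /or4P[]->; rewrite ?orbT.
  move=> yws; exists (index y ws); last by rewrite /w nth_index.
  by rewrite -[y \in ws]index_mem in yws.
rewrite adjE; congr (odd _); apply: eq_card => i; rewrite !inE wadj_K4 // w_eq //.
suff VS n : n < 7 -> (w n \in wverts (S i)) = (n \in piece i) by rewrite !VS.
move=> n7; rewrite V !inE -[c]/(w 0).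
case: (o3 i) => ->; rewrite ?s0 ?s1 ?s2.
- rewrite -[d o0]/(w 1) -[d o1]/(w 2) -[x o0]/(w 4) !w_eq //.
  by rewrite /piece /= !inE !orbA.
- rewrite -[d o1]/(w 2) -[d o2]/(w 3) -[x o1]/(w 5) !w_eq //.
  by rewrite /piece /= !inE !orbA.
- rewrite -[d o2]/(w 3) -[d o0]/(w 1) -[x o2]/(w 6) !w_eq //.
  by rewrite /piece /= !inE -!orbA; congr (_ || _); rewrite orbCA.
Qed.

End PlaneToGrotzsch.

Theorem theorem9 (G : sgraph) :
  plane_multiwheel G \/ projective_plane_multiwheel G ->
  quadrangulates_projective_plane G ->
  grotzsch_class G.
Proof.
case=> [[k [m [S [c [d [[kodd k3] modd pair_i common edge_sum]]]]]]
       |[q [C [m [S [v [q0 data]]]]]]] qpp.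
  have k_3 := plane_three_wheels k3 modd pair_i common edge_sum qpp.
  by subst k; apply: plane_grotzsch modd pair_i common edge_sum qpp.
exists q, C, m, S, v; split=> //.
exact: projective_wheels_are_K4 data qpp.
Qed.
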